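(* Consider, for each $n$, the random-design linear model $Y_i=\mathbf{X}_i'\boldsymbol{\beta}+\varepsilon_i$, $i=1,\dots,n$, with $p_n$ covariates of which the first $k_n$ have nonzero coefficients and the remaining $m_n=p_n-k_n$ have zero coefficients, and let $\widehat{\boldsymbol{\beta}}_n=(\widehat{\boldsymbol{\beta}}_{1n}',\widehat{\boldsymbol{\beta}}_{2n}')'$ be the LS-SCAD estimator with penalty parameters $\lambda_n>0$ and $a>2$ (all as set out in the context). Suppose there exists an absolute constant $M$ (not depending on $n$) such that $\max_{1\le j\le p_n}|X_j|\le M<\infty$, and that: (i) $(\mathbf{X}_i',\varepsilon_i)=(X_{i1},\dots,X_{ip_n},\varepsilon_i)$, $i=1,\dots,n$, are i.i.d., distributed as $(\mathbf{X}',\varepsilon)=(X_1,\dots,X_{p_n},\varepsilon)$, with $E[X_{ij}]=0$, $\mathrm{Var}(X_{ij})=1$, $E[\varepsilon|\mathbf{X}]=0$ and $\mathrm{Var}(\varepsilon|\mathbf{X})=\sigma^2$; (ii) $\lim_{n\to\infty}p_n^2/(n\rho_1^2)=0$ and $\lim_{n\to\infty}k_n\lambda_n^2/\rho_1=0$; (iii) $\lim_{n\to\infty}\sqrt{p_n}/(\sqrt{n\rho_1}\min_{1\le j\le k_n}|\beta_j|)=0$ and $\lim_{n\to\infty}\lambda_n\sqrt{k_n}/(\sqrt{\rho_1}\min_{1\le j\le k_n}|\beta_j|)=0$; (iv) $\lim_{n\to\infty}\sqrt{\max(\pi_{k_n},\omega_{m_n})\,p_n}/(\sqrt{n}\,\rho_1\lambda_n)=0$,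 where $\rho_1$ (which may depend on $n$) is the smallest eigenvalue of $E[\mathbf{X}\mathbf{X}']$, and $\pi_{k_n}$, $\omega_{m_n}$ are the largest eigenvalues of $E[\mathbf{X}_{i1}\mathbf{X}_{i1}']$ and $E[\mathbf{X}_{i2}\mathbf{X}_{i2}']$, respectively. Then $\lim_{n\to\infty}P(\widehat{\boldsymbol{\beta}}_{2n}=\mathbf{0}_{m_n})=1$.
   Context: Setting. For each $n$, observations $(\mathbf{X}_i,Y_i)$, $i=1,\dots,n$, satisfy $Y_i=\mathbf{X}_i'\boldsymbol{\beta}+\varepsilon_i$ (the intercept is taken to be $0$), where $\mathbf{X}_i=(X_{i1},\dots,X_{ip_n})'$ is a random $p_n\times1$ vector, $\varepsilon_i$ is a random error, and $\boldsymbol{\beta}=(\beta_1,\dots,\beta_{p_n})'\in\mathbb{R}^{p_n}$ is nonrandom. The covariates and their law, and the parameters $p_n,k_n,\boldsymbol{\beta},\lambda_n$ may depend on $n$; $a>2$ and $\sigma^2$ are fixed. Write $\boldsymbol{\beta}=(\boldsymbol{\beta}_1',\boldsymbol{\beta}_2')'$ with $\boldsymbol{\beta}_1=(\beta_1,\dots,\beta_{k_n})'$ having all components nonzero and $\boldsymbol{\beta}_2=\mathbf{0}_{m_n}$, $m_n=p_n-k_n$. Correspondingly $\mathbf{X}_{i1}=(X_{i1},\dots,X_{ik_n})'$ and $\mathbf{X}_{i2}=(X_{i,k_n+1},\dots,X_{ip_n})'$ (vectors). Let $\mathbf{Y}=(Y_1,\dots,Y_n)'$ and let $\mathbb{X}=(X_{ij})$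 be the $n\times p_n$ design matrix. $\|\cdot\|$ is the Euclidean norm. Conditions with $\rho_1$ in a denominator are understood with $\rho_1>0$. SCAD penalty. For $a>2$, $\lambda>0$: $p_\lambda(\theta;a)=\lambda|\theta|$ if $|\theta|\le\lambda$; $p_\lambda(\theta;a)=-(\theta^2-2a\lambda|\theta|+\lambda^2)/[2(a-1)]$ if $\lambda<|\theta|\le a\lambda$; $p_\lambda(\theta;a)=(a+1)\lambda^2/2$ if $|\theta|>a\lambda$. LS-SCAD estimator. $\widehat{\boldsymbol{\beta}}_n=\arg\min_{\mathbf{b}\in\mathbb{R}^{p_n}}Q_n(\mathbf{b};\lambda_n,a)$, where $Q_n(\mathbf{b};\lambda_n,a)=\|\mathbf{Y}-\mathbb{X}\mathbf{b}\|^2+n\sum_{j=1}^{p_n}p_{\lambda_n}(b_j;a)$ (a global minimizer). It is partitioned as $\widehat{\boldsymbol{\beta}}_n=(\widehat{\boldsymbol{\beta}}_{1n}',\widehat{\boldsymbol{\beta}}_{2n}')'$ with $\widehat{\boldsymbol{\beta}}_{1n}\in\mathbb{R}^{k_n}$, $\widehat{\boldsymbol{\beta}}_{2n}\in\mathbb{R}^{m_n}$. *)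

(* Defs.v *)
From HB Require Import structures.
From mathcomp Require Export all_boot all_order all_algebra.
From mathcomp Require Export all_classical all_reals all_analysis.

Set Implicit Arguments.
Unset Strict Implicit.
Unset Printing Implicit Defensive.

Export Order.TTheory GRing.Theory Num.Theory.
Export numFieldNormedType.Exports.

Global Open Scope classical_set_scope.
Global Open Scope ring_scope.

Section Probability.
Context {R : realType} {d : measure_display} {T : measurableType d}
  (P : probability T R).

(* Mutual independence: product rule over every finite subfamily. *)
Definition mutually_independent (I : finType) (d' : measure_display)
    (T' : measurableType d') (Z : I -> T -> T') : Prop :=
  forall (J : {set I}) (B : I -> set T'),
    (forall i, i \in J -> measurable (B i)) ->
    P [set t | forall i, i \in J -> B i (Z i t)] =
    (\prod_(i in J) P [set t | B i (Z i t)])%E.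

Definition same_distribution (d' : measure_display) (T' : measurableType d')
    (Z W : T -> T') : Prop :=
  forall B : set T', measurable B -> P (Z @^-1` B) = P (W @^-1` B).

(* g is a version of E[Y | Z], i.e. of the conditional expectation of Y given
   the sigma-algebra generated by Z. *)
Definition is_cond_expectation (d' : measure_display) (T' : measurableType d')
    (Z : T -> T') (Y g : T -> R) : Prop :=
  [/\ P.-integrable [set: T] (EFin \o Y),
      @measurable_fun _ _ (g_sigma_algebra_preimageType Z) R setT g,
      P.-integrable [set: T] (EFin \o g) &
      forall A : set T, g_sigma_algebra_preimage Z A ->
        (\int[P]_(t in A) (g t)%:E = \int[P]_(t in A) (Y t)%:E)%E].

(* v is a version of Var(Y | Z) = E[(Y - E[Y | Z])^2 | Z]. *)
Definition is_cond_variance (d' : measure_display) (T' : measurableType d')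
    (Z : T -> T') (Y v : T -> R) : Prop :=
  exists2 g : T -> R, is_cond_expectation Z Y g &
    is_cond_expectation Z (fun t => (Y t - g t) ^+ 2) v.

(* E[Z Z'], entrywise. *)
Definition second_moment_mx (p : nat) (Z : T -> 'cV[R]_p) : 'M[R]_p :=
  \matrix_(i, j) fine ('E_P[fun t => (Z t *m (Z t)^T) i j])%E.

End Probability.

Section Vectors.
Context {R : realType}.

(* The library puts the product sigma-algebra on tuples, not on matrices;
   random vectors are tuple-valued and read as columns. *)
Definition col_of (p : nat) (x : p.-tuple R) : 'cV[R]_p :=
  \col_j tnth x j.

Definition euclidean_norm (n : nat) (v : 'cV[R]_n) : R :=
  Num.sqrt (\sum_i v i 0 ^+ 2).

(* The spectrum is finite, so for symmetric A of positive size these are the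
   minimum and the maximum of the eigenvalues; both are 0 for the empty
   matrix. *)
Definition smallest_eigenvalue (p : nat) (A : 'M[R]_p) : R :=
  inf [set a : R | eigenvalue A a].

Definition largest_eigenvalue (p : nat) (A : 'M[R]_p) : R :=
  sup [set a : R | eigenvalue A a].

(* min_j |v_j|.  For p = 0 the value is 0 and, since x / 0 = 0, a ratio with
   this denominator is then 0, in agreement with min(empty) = +oo. *)
Definition min_abs (p : nat) (v : 'cV[R]_p) : R :=
  inf [set `|v j 0| | j in [set: 'I_p]].

End Vectors.

Section SCAD.
Context {R : realType}.

Definition scad (lambda a theta : R) : R :=
  if `|theta| <= lambda then lambda * `|theta|
  else if `|theta| <= a * lambda then
    - (theta ^+ 2 - 2 * a * lambda * `|theta| + lambda ^+ 2) / (2 * (a - 1))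
  else (a + 1) * lambda ^+ 2 / 2.

Definition ls_scad_objective (n p : nat) (X : 'M[R]_(n, p)) (Y : 'cV[R]_n)
    (lambda a : R) (b : 'cV[R]_p) : R :=
  euclidean_norm (Y - X *m b) ^+ 2 + n%:R * \sum_j scad lambda a (b j 0).

Definition is_ls_scad_estimate (n p : nat) (X : 'M[R]_(n, p)) (Y : 'cV[R]_n)
    (lambda a : R) (bhat : 'cV[R]_p) : Prop :=
  forall b : 'cV[R]_p,
    ls_scad_objective X Y lambda a bhat <= ls_scad_objective X Y lambda a b.

End SCAD.

(* Main.v *)
Require Import Defs.
From mathcomp Require Import measurable_realfun ring lra.

(* Let u = bhat - beta, S = E[X X'], w = sum_i eps_i X_i and V = w' S^-1 w, so
   that E[V] = n sigma^2 p.  Condition (ii) and Chebyshev's inequality give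
   |XX u|^2 >= (n/2) u'Su for the design matrix XX with probability tending to
   1.  Comparing the objective at bhat and at beta, and bounding 2 w'u by
   (n/4) u'Su + (4/n) V, first shows |u| < min |beta_j| / 2.  Both beta_j and
   bhat_j, j <= k_n, then lie on the flat part of the penalty, and the same
   comparison improves to |u|^2 <= 16 V / (n^2 rho_1) and |XX u|^2 <= 8 V / n.
   If bhat_j <> 0 for some j > k_n, comparing bhat with the vector obtained by
   zeroing its j-th coordinate yields n lambda <= C sqrt (V / rho_1), which by
   Markov's inequality and (iv) has vanishing probability, because rho_1 <= 1
   <= max (pi, omega). *)

(** Measuring the noise w in the norm dual to u'Su has two effects. The mean of V is n sigma^2
    tr(S^-1 S), free of the eigenvalues of S, and the cross term 2 w'u is absorbed by |XX u|^2
    without any spectral loss. The comparison with beta is made twice because at first the penalty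
    difference is only known to be at most k plateau heights (a + 1) lambda^2 / 2. Condition (iii)
    makes this small against min |beta_j|^2; once the signal coordinates of bhat reach the plateau,
    the difference has a favourable sign and drops out. The errors have only a second moment, so a
    union bound over the m null coordinates would be too costly. Instead w_j^2 <= S_jj V = V bounds
    every coordinate on one and the same event {V < c}. Hence the argument splits into a
    deterministic implication, valid for data with a good Gram matrix and a small V, and two
    applications of Markov's inequality. *)

Set Implicit Arguments.
Unset Strict Implicit.
Unset Printing Implicit Defensive.

(** * Bilinear forms u'Sv *)

Section QuadraticForms.
Context {R : realType}.

Definition bilin (p : nat) (S : 'M[R]_p) (u v : 'cV[R]_p) : R :=
  (u^T *m S *m v) 0 0.

Lemma bilinDl p (S : 'M[R]_p) u1 u2 v :
  bilin S (u1 + u2) v = bilin S u1 v + bilin S u2 v.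
Proof. by rewrite /bilin raddfD /= !mulmxDl mxE. Qed.

Lemma bilinDr p (S : 'M[R]_p) u v1 v2 :
  bilin S u (v1 + v2) = bilin S u v1 + bilin S u v2.
Proof. by rewrite /bilin mulmxDr mxE. Qed.

Lemma bilinZl p (S : 'M[R]_p) c u v : bilin S (c *: u) v = c * bilin S u v.
Proof. by rewrite /bilin linearZ /= -!scalemxAl mxE. Qed.

Lemma bilinZr p (S : 'M[R]_p) c u v : bilin S u (c *: v) = c * bilin S u v.
Proof. by rewrite /bilin -scalemxAr mxE. Qed.

Lemma bilin_sum p (S : 'M[R]_p) u v :
  bilin S u v = \sum_i \sum_j S i j * (u i 0 * v j 0).
Proof.
rewrite /bilin mxE exchange_big /=; apply: eq_bigr => j _.
rewrite mxE mulr_suml; apply: eq_bigr => i _.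
by rewrite mxE mulrA [S i j * _]mulrC.
Qed.

Lemma bilin_sym p (S : 'M[R]_p) u v : S^T = S -> bilin S u v = bilin S v u.
Proof.
move=> Ssym; rewrite /bilin.
have -> : u^T *m S *m v = (v^T *m S *m u)^T.
  by rewrite !trmx_mul trmxK Ssym mulmxA.
by rewrite mxE.
Qed.

Lemma bilin_mx n p (X : 'M[R]_(n, p)) (u v : 'cV[R]_p) :
  bilin 1%:M (X *m u) (X *m v) = bilin (X^T *m X) u v.
Proof. by rewrite /bilin mulmx1 trmx_mul !mulmxA. Qed.

Lemma bilin1_sqr n (u : 'cV[R]_n) : bilin 1%:M u u = \sum_i u i 0 ^+ 2.
Proof. by rewrite /bilin mulmx1 mxE; apply: eq_bigr => i _; rewrite mxE expr2. Qed.

Lemma bilin1_ge0 n (u : 'cV[R]_n) : 0 <= bilin 1%:M u u.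
Proof. by rewrite bilin1_sqr sumr_ge0 // => i _; rewrite sqr_ge0. Qed.

Lemma euclidean_norm_sqr n (u : 'cV[R]_n) :
  euclidean_norm u ^+ 2 = bilin 1%:M u u.
Proof. by rewrite bilin1_sqr sqr_sqrtr // sumr_ge0 // => i _; rewrite sqr_ge0. Qed.

Lemma sqr_coord_le n (u : 'cV[R]_n) j : u j 0 ^+ 2 <= bilin 1%:M u u.
Proof.
rewrite bilin1_sqr (bigD1 j) //= lerDl sumr_ge0 // => i _.
exact: sqr_ge0.
Qed.

Lemma bilin_delta p (S : 'M[R]_p) i j :
  bilin S (delta_mx i 0) (delta_mx j 0) = S i j.
Proof. by rewrite /bilin trmx_delta -rowE -colE !mxE. Qed.

Lemma bilin_sqrD p (S : 'M[R]_p) u v t : S^T = S ->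
  bilin S (u + t *: v) (u + t *: v) =
  bilin S u u + 2 * t * bilin S u v + t ^+ 2 * bilin S v v.
Proof.
move=> Ssym; rewrite !(bilinDl, bilinDr, bilinZl, bilinZr).
by rewrite (bilin_sym v u Ssym); ring.
Qed.

(** Nonnegativity of the quadratic polynomial in t at its minimiser. Only semidefiniteness is
    assumed, since the lemma is also applied to the singular matrix [S - mu%:M]. *)
Lemma bilin_CauchySchwarz p (S : 'M[R]_p) u v : S^T = S ->
  (forall w, 0 <= bilin S w w) ->
  bilin S u v ^+ 2 <= bilin S u u * bilin S v v.
Proof.
move=> Ssym Spsd.
have : forall t, 0 <= bilin S u u + 2 * t * bilin S u v + t ^+ 2 * bilin S v v.
  by move=> t; rewrite -bilin_sqrD.
move: (Spsd u) (Spsd v); set A := bilin S u u; set B := bilin S u v.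
set C := bilin S v v => A0 C0 H.
have [C_gt0|C_eq0] := ltrP 0 C.
  have := H (- (B / C)); rewrite sqrrN.
  rewrite -(pmulr_lge0 _ C_gt0) => H'.
  rewrite -subr_ge0; apply: le_trans H' _; rewrite le_eqVlt; apply/orP; left.
  by apply/eqP; field; rewrite gt_eqF.
have C1 : C = 0 by lra.
have [->|B0] := eqVneq B 0; first by rewrite C1 mulr0 expr0n.
(* With C = 0 the polynomial is affine in t, and this t gives it the value -1. *)
have := H (- (A + 1) / (2 * B)); rewrite C1 mulr0 addr0.
suff -> : A + 2 * (- (A + 1) / (2 * B)) * B = -1 by rewrite ler0N1.
by field.
Qed.

(** Turns the noise pairing u'w into an [S]-inner product, so that Cauchy-Schwarz and Young's
    inequality apply in the geometry of [S]. *)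
Lemma bilin_inv p (S : 'M[R]_p) u w : S \in unitmx ->
  bilin S u (invmx S *m w) = (u^T *m w) 0 0.
Proof. by move=> Su; rewrite /bilin -mulmxA mulKVmx. Qed.

Lemma bilin_invinv p (S : 'M[R]_p) w : S^T = S -> S \in unitmx ->
  bilin S (invmx S *m w) (invmx S *m w) = bilin (invmx S) w w.
Proof.
move=> Ssym Su; rewrite bilin_inv // trmx_mul trmx_inv Ssym.
by rewrite /bilin.
Qed.

Lemma posdef_unit p (S : 'M[R]_p) rho : 0 < rho ->
  (forall u, rho * bilin 1%:M u u <= bilin S u u) -> S \in unitmx.
Proof.
move=> rho_gt0 Srho; rewrite -row_free_unit; apply: inj_row_free => v vS.
have := Srho v^T; rewrite [bilin S _ _]/bilin trmxK vS mul0mx mxE.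
rewrite pmulr_rle0 // => v_le0.
have : bilin 1%:M v^T v^T = 0 by apply/le_anti; rewrite v_le0 bilin1_ge0.
rewrite bilin1_sqr => /psumr_eq0P v0.
apply/rowP => j; rewrite mxE.
have /eqP := v0 (fun i _ => sqr_ge0 _) j isT.
by rewrite mxE sqrf_eq0 => /eqP.
Qed.

End QuadraticForms.

(** * Bounds on the SCAD penalty *)

Section Scad.
Context {R : realType}.
Implicit Types lambda a theta : R.

Lemma scad0 lambda a : 0 < lambda -> scad lambda a 0 = 0.
Proof. by move=> l0; rewrite /scad normr0 ltW // mulr0. Qed.

Lemma scad_ge0 lambda a theta : 2 < a -> 0 < lambda -> 0 <= scad lambda a theta.
Proof.
move=> a2 l0; rewrite /scad; case: ifPn => [_|]; first by rewrite mulr_ge0 // ltW.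
rewrite -ltNge => lt1; case: ifPn => [lt2|_].
  rewrite divr_ge0 //; last by lra.
  rewrite -[theta ^+ 2]real_normK ?num_real //.
  move: lt1 lt2; set t := `|theta| => lt1 lt2.
  suff : 0 <= (a * lambda - t) * (t - lambda) + a * lambda * (t - lambda) +
              lambda * (t - lambda) + (a - 1) * lambda ^+ 2 by nra.
  have ? : 0 <= (a - 1) * lambda ^+ 2 by rewrite mulr_ge0 ?sqr_ge0 //; lra.
  have ? : 0 <= (a * lambda - t) * (t - lambda) by rewrite mulr_ge0; lra.
  have ? : 0 <= a * lambda * (t - lambda) by rewrite mulr_ge0 ?mulr_ge0; lra.
  have ? : 0 <= lambda * (t - lambda) by rewrite mulr_ge0; lra.
  lra.
by rewrite divr_ge0 // mulr_ge0 ?sqr_ge0 //; lra.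
Qed.

Lemma scad_le lambda a theta : 2 < a -> 0 < lambda ->
  scad lambda a theta <= (a + 1) * lambda ^+ 2 / 2.
Proof.
move=> a2 l0; rewrite /scad; case: ifPn => [lt1|].
  have ? : lambda * `|theta| <= lambda * lambda by rewrite ler_pM2l.
  have ? : 0 <= (a - 1) * lambda ^+ 2 by rewrite mulr_ge0 ?sqr_ge0 //; lra.
  by lra.
rewrite -ltNge => lt1; case: ifPn => [lt2|_]; last by [].
rewrite ler_pdivrMr; last by lra.
rewrite -[theta ^+ 2]real_normK ?num_real //.
(* On the middle branch the gap to the plateau, times 2(a - 1), is exactly this square. *)
have := sqr_ge0 (`|theta| - a * lambda); lra.
Qed.

Lemma scad_large lambda a theta : 0 < lambda -> 2 < a -> a * lambda < `|theta| ->
  scad lambda a theta = (a + 1) * lambda ^+ 2 / 2.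
Proof.
move=> l0 a2 h; rewrite /scad.
have ? : 2 * lambda <= a * lambda by rewrite ler_pM2r // ltW.
by rewrite !ifF //; apply/negbTE; rewrite -ltNge; lra.
Qed.

Lemma scad_small lambda a theta : `|theta| <= lambda ->
  scad lambda a theta = lambda * `|theta|.
Proof. by rewrite /scad => ->. Qed.

End Scad.

(** * Deterministic part: sparsity of the minimiser for good data *)

Section Selection.
Context {R : realType}.

(** The Frobenius norm dominates the operator norm, so the error of the empirical Gram matrix costs
    at most (rho / 2)|u|^2, which is at most half of u'Su. *)
Lemma gram_lower_bound n p (X : 'M[R]_(n, p)) (S : 'M[R]_p) rho :
  (0 < n)%N -> 0 < rho ->
  (forall u, rho * bilin 1%:M u u <= bilin S u u) ->
  \sum_i \sum_j (n%:R^-1 * (X^T *m X) i j - S i j) ^+ 2 <= rho ^+ 2 / 4 ->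
  forall u, n%:R / 2 * bilin S u u <= bilin 1%:M (X *m u) (X *m u).
Proof.
move=> n_gt0 rho_gt0 Srho; rewrite pair_big /= => frob u.
have nR : 0 < n%:R :> R by rewrite ltr0n.
set E : 'M[R]_p := \matrix_(i, j) (n%:R^-1 * (X^T *m X) i j - S i j).
have XE : n%:R^-1 * bilin 1%:M (X *m u) (X *m u) = bilin S u u + bilin E u u.
  rewrite bilin_mx !bilin_sum mulr_sumr -big_split /=; apply: eq_bigr => i _.
  rewrite mulr_sumr -big_split /=; apply: eq_bigr => j _.
  by rewrite [E i j]mxE; ring.
set q := bilin 1%:M u u.
have q_ge0 : 0 <= q by exact: bilin1_ge0.
(* Young's inequality entrywise, weighted so that the bound [frob] on the
   squared Frobenius norm of [E] balances [q ^+ 2]. *)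
have E_lb : - (rho / 2) * q <= bilin E u u.
  (* The Young weight rho / (4q) requires q to be nonzero. *)
  have [q0|q_gt0] := eqVneq q 0.
    rewrite q0 mulr0 bilin_sum big1 // => i _; rewrite big1 // => j _.
    have : u i 0 ^+ 2 = 0.
      by apply/le_anti; rewrite sqr_ge0 andbT -q0 sqr_coord_le.
    by move/eqP; rewrite sqrf_eq0 => /eqP ->; rewrite mul0r mulr0.
  have {}q_gt0 : 0 < q by rewrite lt_neqAle eq_sym q_gt0.
  have q2 : \sum_(ij : 'I_p * 'I_p) (u ij.1 0 * u ij.2 0) ^+ 2 = q ^+ 2.
    rewrite expr2 /q !bilin1_sqr mulr_suml -(pair_big predT predT
      (fun i j => (u i 0 * u j 0) ^+ 2)) /=; apply: eq_bigr => i _.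
    by rewrite mulr_sumr; apply: eq_bigr => j _; rewrite exprMn.
  rewrite bilin_sum pair_big /=.
  suff : \sum_(ij : 'I_p * 'I_p) (- (q / rho) * (n%:R^-1 * (X^T *m X) ij.1 ij.2 - S ij.1 ij.2) ^+ 2
            + - (rho / (4 * q)) * (u ij.1 0 * u ij.2 0) ^+ 2) <=
         \sum_(ij : 'I_p * 'I_p) E ij.1 ij.2 * (u ij.1 0 * u ij.2 0).
    apply: le_trans; rewrite big_split /= -!mulr_sumr q2.
    move: frob; set F := \sum_(_ | _) _ => frob.
    have -> : - (rho / (4 * q)) * q ^+ 2 = - (rho / 4) * q.
      by field; rewrite gt_eqF.
    have : (q / rho) * F <= (q / rho) * (rho ^+ 2 / 4).
      by rewrite ler_wpM2l // divr_ge0 // ltW.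
    have -> : q / rho * (rho ^+ 2 / 4) = rho / 4 * q by field; rewrite gt_eqF.
    lra.
  apply: ler_sum => -[i j] _ /=; rewrite [E i j]mxE.
  set e := _ - _; set x := u i 0 * u j 0.
  rewrite -subr_ge0.
  have -> : e * x - (- (q / rho) * e ^+ 2 + - (rho / (4 * q)) * x ^+ 2) =
            q / rho * (e + rho / (2 * q) * x) ^+ 2.
    by field; rewrite !gt_eqF.
  by rewrite mulr_ge0 ?sqr_ge0 // divr_ge0 // ltW.
have := Srho u; rewrite -/q => Su.
have -> : bilin 1%:M (X *m u) (X *m u) =
  n%:R * (bilin S u u + bilin E u u) by rewrite -XE mulVKf ?gt_eqF.
by rewrite -mulrA ler_pM2l //; lra.
Qed.

(** No probability is involved: the data enter through the entry bound, the Frobenius bound and the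
    size of [V]. In the constant, 2 comes from the score coordinate, 6M from the cross term with
    [X *m u], and 4M^2 from the squared column norm. *)
Lemma scad_estimate_sparse n p (X : 'M[R]_(n, p)) (S : 'M[R]_p)
    (beta b : 'cV[R]_p) (e : 'cV[R]_n) (lambda a rho M : R) :
  let V := bilin (invmx S) (X^T *m e) (X^T *m e) in
  2 < a -> 0 < lambda -> 0 < rho -> 1 <= M -> (0 < n)%N ->
  S^T = S -> (forall j, S j j = 1) ->
  (forall u, rho * bilin 1%:M u u <= bilin S u u) ->
  (forall i j, `|X i j| <= M) ->
  \sum_i \sum_j (n%:R^-1 * (X^T *m X) i j - S i j) ^+ 2 <= rho ^+ 2 / 4 ->
  is_ls_scad_estimate X (X *m beta + e) lambda a b ->
  (forall j, beta j 0 != 0 -> 2 * a * lambda <= `|beta j 0| /\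
     16 * V / (n%:R ^+ 2 * rho) +
     2 * (#|[pred j | beta j 0 != 0]|)%:R * (a + 1) * lambda ^+ 2 / rho
       < `|beta j 0| ^+ 2 / 4) ->
  (2 + 6 * M + 4 * M ^+ 2) ^+ 2 * V < n%:R ^+ 2 * lambda ^+ 2 * rho ->
  forall j, beta j 0 = 0 -> b j 0 = 0.
Proof.
move=> V a2 lambda_gt0 rho_gt0 M1 n_gt0 Ssym Sdiag Srho XM frob est beta_big V_small.
have M_ge0 : 0 <= M by exact: le_trans M1.
have Xlow := gram_lower_bound n_gt0 rho_gt0 Srho frob.
have nR : 0 < n%:R :> R by rewrite ltr0n.
have Sunit := posdef_unit rho_gt0 Srho.
have Spsd w : 0 <= bilin S w w.
  by apply: le_trans (Srho w); rewrite mulr_ge0 ?bilin1_ge0 // ltW.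
pose w := X^T *m e.
have VE : V = bilin S (invmx S *m w) (invmx S *m w) by rewrite bilin_invinv.
have V_ge0 : 0 <= V by rewrite VE.
set u := b - beta.
have bE : b = beta + u by rewrite /u addrC subrK.
have resid : X *m beta + e - X *m b = e + (-1) *: (X *m u).
  by rewrite bE mulmxDr scaleN1r opprD addrACA subrr add0r.
have wu : bilin 1%:M e (X *m u) = (u^T *m w) 0 0.
  rewrite bilin_sym ?trmx1 // /bilin mulmx1 trmx_mul -mulmxA.
  by [].
pose G := bilin 1%:M (X *m u) (X *m u).
pose F := bilin S u u.
pose g := (u^T *m w) 0 0.
(* Positivity of the quadratic form at [S^-1 w - (n/4) u]. *)
have young : 2 * g <= n%:R / 4 * F + 4 / n%:R * V.
  have := Spsd (invmx S *m w + (- (n%:R / 4)) *: u).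
  rewrite bilin_sqrD // -VE (bilin_sym _ u) // bilin_inv // -/g -/F => h.
  have : 0 <= 4 / n%:R * (V + 2 * - (n%:R / 4) * g + (- (n%:R / 4)) ^+ 2 * F).
    by rewrite mulr_ge0 // divr_ge0 // ltW.
  have -> : 4 / n%:R * (V + 2 * - (n%:R / 4) * g + (- (n%:R / 4)) ^+ 2 * F) =
     4 / n%:R * V - 2 * g + n%:R / 4 * F by field; rewrite gt_eqF.
  lra.
pose Delta := \sum_j (scad lambda a (beta j 0) - scad lambda a (b j 0)).
have basic : G - 2 * g <= n%:R * Delta.
  have := est beta; rewrite /ls_scad_objective !euclidean_norm_sqr resid.
  have -> : X *m beta + e - X *m beta = e by rewrite addrC addKr.
  rewrite bilin_sqrD ?trmx1 // wu -/g -/G /Delta sumrB mulrBr.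
  lra.
have FG : n%:R / 2 * F <= G by exact: Xlow.
have Fq : rho * bilin 1%:M u u <= F by exact: Srho.
(* Of the n/2 [F] given by [FG], [young] consumes n/4 [F]; the remaining n/4 [F] is at most 4/n [V]
   + n [Delta]. *)
have qbound : bilin 1%:M u u <= 16 * V / (n%:R ^+ 2 * rho) + 4 * Delta / rho.
  have -> : 16 * V / (n%:R ^+ 2 * rho) + 4 * Delta / rho =
    (4 / n%:R * (4 / n%:R * V + n%:R * Delta)) / rho.
    by field; rewrite !gt_eqF.
  rewrite ler_pdivlMr // mulrC; apply: le_trans Fq _.
  have -> : F = 4 / n%:R * (n%:R / 4 * F) by field; rewrite gt_eqF.
  rewrite ler_pM2l ?divr_gt0 //; lra.
(* A nonzero coefficient contributes at most the plateau height, a zero one a nonpositive term. *)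
have Delta_le : Delta <= (#|[pred j | beta j 0 != 0]|)%:R * ((a + 1) * lambda ^+ 2 / 2).
  rewrite -sum1_card natr_sum mulr_suml big_mkcond /=; apply: ler_sum => j _.
  have ? := scad_ge0 (b j 0) a2 lambda_gt0.
  case: ifPn => [_|]; first by have := scad_le (beta j 0) a2 lambda_gt0; lra.
  by rewrite inE negbK => /eqP ->; rewrite scad0 //; lra.
have u_small j : beta j 0 != 0 -> `|u j 0| < `|beta j 0| / 2.
  move=> /[dup] bj0 /beta_big[_ lt].
  rewrite -(@ltr_pXn2r _ 2) ?nnegrE ?divr_ge0 //.
  rewrite real_normK ?num_real //.
  apply: le_lt_trans (sqr_coord_le u j) _; apply: le_lt_trans qbound _.
  have -> : (`|beta j 0| / 2) ^+ 2 = `|beta j 0| ^+ 2 / 4 by field.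
  apply: le_lt_trans lt.
  rewrite lerD2l ler_pM2r ?invr_gt0 //; lra.
(* From |beta_j| >= 2 a lambda and |u_j| < |beta_j| / 2 follows |b_j| > a lambda, so the penalty of
   [b] is maximal at each signal coordinate. *)
have Delta_le0 : Delta <= 0.
  rewrite /Delta sumr_le0 // => j _.
  have [bj|bj] := eqVneq (beta j 0) 0.
    by rewrite bj scad0 // sub0r oppr_le0 scad_ge0.
  have ltu := u_small j bj; have [leb _] := beta_big j bj.
  have b_big : `|beta j 0| / 2 < `|b j 0|.
    have : `|beta j 0| <= `|b j 0| + `|u j 0|.
      by rewrite bE mxE (le_trans _ (ler_normB _ _)) // addrK.
    lra.
  by rewrite (@scad_large _ _ _ (b j 0)) //; have := scad_le (beta j 0) a2 lambda_gt0; lra.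
have {}qbound : bilin 1%:M u u <= 16 * V / (n%:R ^+ 2 * rho).
  apply: le_trans qbound _; rewrite gerDl pmulr_lle0 ?invr_gt0 //; lra.
(* By [FG] the n/4 [F] in [young] is at most [G] / 2. *)
have Gbound : G <= 8 / n%:R * V.
  have nD : n%:R * Delta <= 0 by rewrite pmulr_rle0.
  have := young; have -> : 8 / n%:R * V = 2 * (4 / n%:R * V) by ring.
  lra.
move=> j bj0; apply/eqP; apply: contraT => x_neq0.
have uj : u j 0 = b j 0 by rewrite /u !mxE bj0 subr0.
set x := b j 0 in x_neq0 uj.
(* Common scale of all remaining estimates; the unit diagonal forces rho <= 1, so also [V] <=
   s^2. *)
set s := Num.sqrt (V / rho).
have s2 : s ^+ 2 = V / rho by rewrite sqr_sqrtr // divr_ge0 // ltW.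
have s_ge0 : 0 <= s by exact: sqrtr_ge0.
have rho1 : rho <= 1.
  have := Srho (delta_mx j 0); rewrite !bilin_delta Sdiag mxE eqxx mulr1.
  by [].
have V_le : V <= s ^+ 2.
  by rewrite s2 ler_pdivlMr // ler_piMr.
have nx : n%:R * `|x| <= 4 * s.
  rewrite -(@ler_pXn2r _ 2) ?nnegrE ?mulr_ge0 ?ler0n //.
  rewrite !exprMn real_normK ?num_real // s2 -uj.
  rewrite -ler_pdivlMl ?exprn_gt0 //.
  apply: le_trans (sqr_coord_le u j) _; apply: le_trans qbound _.
  rewrite le_eqVlt; apply/orP; left; apply/eqP.
  by field; rewrite !gt_eqF.
(* w_j is the [S]-inner product of the j-th basis vector, of [S]-norm 1, with S^-1 w, whose squared
   [S]-norm is [V]. *)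
have w_le : `|w j 0| <= s.
  rewrite -(@ler_pXn2r _ 2) ?nnegrE // real_normK ?num_real //.
  apply: le_trans V_le.
  have := bilin_CauchySchwarz (delta_mx j 0) (invmx S *m w) Ssym Spsd.
  by rewrite bilin_inv // -VE bilin_delta Sdiag mul1r trmx_delta -rowE mxE.
pose c : 'cV[R]_n := X *m delta_mx j 0.
have c2 : bilin 1%:M c c <= n%:R * M ^+ 2.
  rewrite bilin1_sqr -[n in n%:R]card_ord -sum1_card natr_sum mulr_suml.
  apply: ler_sum => i _; rewrite mul1r /c -colE mxE.
  by rewrite -[_ ^+ 2]real_normK ?num_real // lerXn2r ?nnegrE // (le_trans _ M1).
(* The factors n in |c|^2 <= n M^2 and [Gbound] cancel, leaving 8 M^2 [V]; 3 is a rational bound for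
   the root of 8. *)
have cXu : `|bilin 1%:M c (X *m u)| <= 3 * M * s.
  rewrite -(@ler_pXn2r _ 2) ?nnegrE // ?mulr_ge0 //.
  rewrite real_normK ?num_real //.
  apply: le_trans (bilin_CauchySchwarz _ _ (trmx1 _ _) (@bilin1_ge0 _ _)) _.
  apply: (@le_trans _ _ (n%:R * M ^+ 2 * (8 / n%:R * V))).
    by rewrite ler_pM // bilin1_ge0.
  have -> : n%:R * M ^+ 2 * (8 / n%:R * V) = M ^+ 2 * (8 * V) by field; rewrite gt_eqF.
  have -> : (3 * M * s) ^+ 2 = M ^+ 2 * (9 * s ^+ 2) by ring.
  rewrite ler_wpM2l ?sqr_ge0 //; lra.
have ce : bilin 1%:M c e = w j 0.
  by rewrite /c /bilin mulmx1 trmx_mul -mulmxA trmx_delta -rowE mxE.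
(* As M >= 1, the constant in [V_small] exceeds 4, so 4s < n lambda. The penalty removed by zeroing
   x therefore lies on the linear branch and equals lambda |x|. *)
have x_small : `|x| <= lambda.
  have : n%:R * lambda > 4 * s.
    rewrite -(@ltr_pXn2r _ 2) ?nnegrE ?mulr_ge0 ?ler0n // ?ltW //.
    rewrite !exprMn s2 mulrA ltr_pdivrMr //; apply: le_lt_trans V_small.
    rewrite ler_wpM2r // lerXn2r ?nnegrE //; nra.
  move=> h; rewrite -(ler_pM2l nR); apply: ltW; exact: le_lt_trans h.
have opt := est (b + (- x) *: delta_mx j 0).
have main : n%:R * lambda <= (2 + 6 * M + 4 * M ^+ 2) * s.
  move: opt; rewrite /ls_scad_objective !euclidean_norm_sqr.
  have -> : X *m beta + e - X *m (b + - x *: delta_mx j 0) =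
            X *m beta + e - X *m b + x *: c.
    by rewrite mulmxDr -scalemxAr scaleNr opprD opprK addrA.
  rewrite (bilin_sqrD _ c) ?trmx1 // [\sum_(k < p) scad _ _ (b k 0)](bigD1 j) //=.
  rewrite [\sum_(k < p) scad _ _ ((b + _) k 0)](bigD1 j) //=.
  rewrite -/x !mxE !eqxx mulr1 subrr scad0 // add0r.
  have -> : \sum_(i < p | i != j) scad lambda a ((b + - x *: delta_mx j 0) i 0) =
            \sum_(i < p | i != j) scad lambda a (b i 0).
    by apply: eq_bigr => k kj; rewrite !mxE (negbTE kj) mulr0 addr0.
  rewrite resid [bilin _ (e + _) c]bilinDl bilinZl bilin_sym ?trmx1 // ce.
  rewrite [bilin _ (X *m u) c]bilin_sym ?trmx1 //.
  rewrite scad_small // => opt.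
  have {}opt : n%:R * (lambda * `|x|) <=
      2 * x * (w j 0 + -1 * bilin 1%:M c (X *m u)) + x ^+ 2 * bilin 1%:M c c by lra.
  have x_gt0 : 0 < `|x| by rewrite normr_gt0.
  rewrite -(ler_pM2r x_gt0) -mulrA; apply: le_trans opt _.
  have t1 : 2 * x * (w j 0 + -1 * bilin 1%:M c (X *m u)) <= (2 + 6 * M) * s * `|x|.
    apply: le_trans (ler_norm _) _; rewrite !normrM mulrAC ler_wpM2r //.
    rewrite normr_nat.
    have := ler_normB (w j 0) (bilin 1%:M c (X *m u)); rewrite mulN1r; lra.
  (* One factor |x| pairs with the n of |c|^2 through n|x| <= 4s; the other is cancelled against the
     penalty gain. *)
  have t2 : x ^+ 2 * bilin 1%:M c c <= 4 * M ^+ 2 * s * `|x|.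
    apply: (@le_trans _ _ (x ^+ 2 * (n%:R * M ^+ 2))).
      by rewrite ler_wpM2l ?sqr_ge0.
    rewrite -[x ^+ 2]real_normK ?num_real //.
    have -> : `|x| ^+ 2 * (n%:R * M ^+ 2) = (M ^+ 2 * `|x|) * (n%:R * `|x|) by ring.
    have -> : 4 * M ^+ 2 * s * `|x| = M ^+ 2 * `|x| * (4 * s) by ring.
    by rewrite ler_wpM2l // mulr_ge0 ?sqr_ge0.
  lra.
move: V_small; rewrite ltNge => /negP; case.
have : (n%:R * lambda) ^+ 2 <= ((2 + 6 * M + 4 * M ^+ 2) * s) ^+ 2.
  have C_ge0 : 0 <= 2 + 6 * M + 4 * M ^+ 2 by have := sqr_ge0 M; lra.
  by rewrite lerXn2r // nnegrE mulr_ge0 // ltW.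
rewrite exprMn [X in _ <= X]exprMn s2 => h.
by rewrite -ler_pdivlMr // -[X in _ <= X]mulrA.
Qed.

End Selection.

(** * Extreme eigenvalues and quadratic forms *)

Section Rayleigh.
Context {R : realType}.

Lemma bilin_continuous p (S : 'M[R]_p) :
  continuous (fun v : 'rV[R]_p => bilin S v^T v^T).
Proof.
rewrite [X in continuous X](_ : _ =
    (fun w : 'rV[R]_p => \sum_i \sum_j S i j * (w 0 i * w 0 j))); last first.
  apply/funext => w; rewrite bilin_sum; apply: eq_bigr => i _.
  by apply: eq_bigr => j _; rewrite !mxE.
apply: continuous_big => [|i _]; first exact: add_continuous.
apply: continuous_big => [|j _]; first exact: add_continuous.
move=> v; apply: (@continuousM _ _ (fun=> S i j) (fun w : 'rV[R]_p => w 0 i * w 0 j)).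
  exact: cst_continuous.
apply: (@continuousM _ _ (fun w : 'rV[R]_p => w 0 i) (fun w : 'rV[R]_p => w 0 j));
  exact: coord_continuous.
Qed.

(* The minimiser of the quadratic form on the unit sphere is an eigenvector. *)
Lemma exists_min_eigenvalue p (S : 'M[R]_p) : (0 < p)%N -> S^T = S ->
  exists2 mu, eigenvalue S mu &
    forall u, mu * bilin 1%:M u u <= bilin S u u.
Proof.
case: p S => // p S _ Ssym.
pose A := [set v : 'rV[R]_p.+1 | bilin 1%:M v^T v^T = 1].
have A0 : A !=set0.
  by exists (delta_mx 0 0); rewrite /A /= trmx_delta bilin_delta mxE eqxx.
have cA : compact A.
  apply: bounded_closed_compact.
    exists 1; split; first exact: num_real.
    move=> x x1 v Av; rewrite /Num.norm /= mx_normrE; apply: bigmax_le => [|[i j] _ /=].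
      by rewrite ltW // (lt_trans _ x1).
    apply: le_trans (ltW x1); rewrite -(@ler_pXn2r _ 2) ?nnegrE //.
    rewrite real_normK ?num_real // expr1n -Av.
    by have := sqr_coord_le v^T j; rewrite mxE ord1.
  rewrite (_ : A = (fun v : 'rV[R]_p.+1 => bilin 1%:M v^T v^T) @^-1` [set 1]) //.
  apply: preimage_closed => [v _|]; first exact: bilin_continuous.
  exact: closed_eq.
have cf : {within A, continuous (fun v : 'rV[R]_p.+1 => bilin S v^T v^T)}.
  by apply: continuous_subspaceT; exact: bilin_continuous.
have [c /[!inE] Ac cmin] := compact_EVT_min A0 cA cf.
pose mu := bilin S c^T c^T.
have mu_le u : mu * bilin 1%:M u u <= bilin S u u.
  have [q0|q_neq0] := eqVneq (bilin 1%:M u u) 0.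
    rewrite q0 mulr0.
    suff -> : u = 0 by rewrite /bilin trmx0 !mul0mx mxE.
    apply/colP => i; rewrite mxE; apply/eqP; rewrite -sqrf_eq0.
    by rewrite eq_le sqr_ge0 andbT -q0 sqr_coord_le.
  have q_gt0 : 0 < bilin 1%:M u u by rewrite lt_neqAle eq_sym q_neq0 bilin1_ge0.
  set q := bilin _ u u in q_neq0 q_gt0 *.
  pose r := (Num.sqrt q)^-1.
  have r2 : r ^+ 2 = q^-1 by rewrite exprVn sqr_sqrtr // ltW.
  have := cmin (r *: u^T); rewrite inE /A /= linearZ /= trmxK.
  rewrite !(bilinZl, bilinZr) !mulrA -!expr2 r2 mulVf // => /(_ erefl).
  by rewrite mulrC ler_pdivlMr.
exists mu => //; apply/eigenvalueP; exists c; last first.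
  apply: contra_eq_neq Ac => ->.
  by rewrite /bilin trmx0 mulmx0 mxE eq_sym oner_eq0.
(* The form of [B] is semidefinite and vanishes at c, so Cauchy-Schwarz for [B] makes c orthogonal
   to every basis vector, that is, c lies in the kernel of [B]. *)
pose B := S - mu%:M.
have BE u v : bilin B u v = bilin S u v - mu * bilin 1%:M u v.
  by rewrite /bilin /B mulmxBr mulmxBl mul_mx_scalar -scalemxAl mulmx1 !mxE.
have Bsym : B^T = B by rewrite /B linearB /= Ssym tr_scalar_mx.
have Bpsd u : 0 <= bilin B u u by rewrite BE subr_ge0.
have Bc : bilin B c^T c^T = 0 by rewrite BE Ac mulr1 subrr.
apply/eqP; rewrite -subr_eq0 -mul_mx_scalar -mulmxBr -/B; apply/eqP/rowP => j.
have := bilin_CauchySchwarz c^T (delta_mx j 0) Bsym Bpsd.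
rewrite Bc mul0r => h.
have : bilin B c^T (delta_mx j 0) = 0.
  by apply/eqP; rewrite -sqrf_eq0 eq_le h sqr_ge0.
by rewrite /bilin trmxK -colE !mxE.
Qed.

Lemma eigenvalue_bilin p (S : 'M[R]_p) mu : eigenvalue S mu ->
  exists2 v : 'cV[R]_p, 0 < bilin 1%:M v v & bilin S v v = mu * bilin 1%:M v v.
Proof.
move=> /eigenvalueP[v vS v0]; exists v^T; last first.
  by rewrite /bilin trmxK vS mulmx1 -scalemxAl mxE.
rewrite lt_neqAle bilin1_ge0 andbT eq_sym; apply: contra v0 => /eqP q0.
apply/eqP/rowP => i; rewrite mxE; apply/eqP; rewrite -sqrf_eq0.
rewrite eq_le sqr_ge0 andbT -q0; have := sqr_coord_le v^T i.
by rewrite mxE.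
Qed.

(** The minimum [mu] of the form on the sphere belongs to the spectrum and bounds it below, so the
    infimum is genuine and at most [mu]. In dimension 0 both sides vanish. *)
Lemma smallest_eigenvalue_bilin p (S : 'M[R]_p) : S^T = S ->
  forall u, smallest_eigenvalue S * bilin 1%:M u u <= bilin S u u.
Proof.
case: p S => [|p] S Ssym u.
  by rewrite !bilin_sum !big_ord0 mulr0.
have [mu emu mule] := exists_min_eigenvalue (ltn0Sn p) Ssym.
apply: le_trans (mule u); rewrite ler_wpM2r ?bilin1_ge0 //.
apply: ge_inf => //; exists mu => nu /= /eigenvalue_bilin[v v0 Sv].
by rewrite -(ler_pM2r v0) -Sv.
Qed.

(** The minimum principle for [- S], tested at the i-th basis vector. *)
Lemma largest_eigenvalue_diag p (S : 'M[R]_p) i : S^T = S ->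
  S i i <= largest_eigenvalue S.
Proof.
move=> Ssym; have p_gt0 : (0 < p)%N by case: p S i Ssym => // S [].
have NSsym : (- S)^T = - S by rewrite linearN /= Ssym.
have bilinN u : bilin (- S) u u = - bilin S u u.
  by rewrite /bilin mulmxN mulNmx mxE.
have [mu emu mule] := exists_min_eigenvalue p_gt0 NSsym.
have ubmu : forall nu, eigenvalue S nu -> nu <= - mu.
  move=> nu /eigenvalue_bilin[v v0 Sv].
  by rewrite -(ler_pM2r v0) -Sv mulNr lerNr -bilinN.
apply: (@le_trans _ _ (- mu)).
  have := mule (delta_mx i 0); rewrite bilinN !bilin_delta mxE eqxx mulr1.
  by rewrite lerNr.
apply: ub_le_sup; first by exists (- mu) => nu /=; exact: ubmu.
move: emu => /eigenvalueP[v vS v0]; apply/eigenvalueP; exists v => //.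
by rewrite scaleNr -vS mulmxN opprK.
Qed.

End Rayleigh.

(** * Calculus of finite means *)

Section HasMean.
Context {R : realType} {d : measure_display} {T : measurableType d}
  (P : probability T R).

(** Integrability and value are bundled so that linearity carries no side conditions. *)
Definition has_mean (f : T -> R) (e : R) : Prop :=
  P.-integrable [set: T] (EFin \o f) /\ (\int[P]_x (f x)%:E = e%:E)%E.

Lemma has_mean_measurable f e : has_mean f e -> measurable_fun [set: T] f.
Proof. by move=> [/measurable_int/measurable_EFinP]. Qed.

Lemma integrable_has_mean f : P.-integrable [set: T] (EFin \o f) ->
  has_mean f (fine (\int[P]_x (f x)%:E)%E).
Proof. by move=> fi; split=> //; rewrite fineK //; exact: integrable_fin_num. Qed.

Lemma has_mean_eq f g e : f =1 g -> has_mean f e -> has_mean g e.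
Proof. by move=> /funext ->. Qed.

Lemma has_mean_uniq f e1 e2 : has_mean f e1 -> has_mean f e2 -> e1 = e2.
Proof. by move=> [_ E1] [_ E2]; move: E1; rewrite E2 => -[]. Qed.

Lemma has_mean_cst c : has_mean (fun=> c) c.
Proof.
split; first exact: (@finite_measure_integrable_cst _ _ _ P _ c measurableT).
rewrite (integral_cst P measurableT).
by rewrite [X in (_ * X)%E](_ : _ = 1%E) ?mule1 //; exact: probability_setT.
Qed.

Lemma has_meanD f g a b : has_mean f a -> has_mean g b ->
  has_mean (fun x => f x + g x) (a + b).
Proof.
move=> [fi fE] [gi gE]; split; first exact: (integrableD measurableT fi gi).
by rewrite EFinD -fE -gE -integralD_EFin.
Qed.

Lemma has_meanZ c f a : has_mean f a -> has_mean (fun x => c * f x) (c * a).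
Proof.
move=> [fi fE]; split; first exact: (integrableZl measurableT c fi).
by rewrite EFinM -fE -integralZl.
Qed.

Lemma has_meanB f g a b : has_mean f a -> has_mean g b ->
  has_mean (fun x => f x - g x) (a - b).
Proof.
move=> fa /(has_meanZ (-1)) gb; rewrite -mulN1r.
by apply: has_mean_eq (has_meanD fa gb) => x; rewrite mulN1r.
Qed.

Lemma has_mean_sum (I : Type) (r : seq I) (Q : pred I) (f : I -> T -> R) (e : I -> R) :
  (forall i, Q i -> has_mean (f i) (e i)) ->
  has_mean (fun x => \sum_(i <- r | Q i) f i x) (\sum_(i <- r | Q i) e i).
Proof.
move=> fe; elim: r => [|i r ih].
  rewrite big_nil; apply: has_mean_eq (has_mean_cst 0) => x.
  by rewrite big_nil.
rewrite big_cons; case: ifPn => Qi; last first.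
  by apply: has_mean_eq ih => x; rewrite big_cons (negbTE Qi).
by apply: has_mean_eq (has_meanD (fe i Qi) ih) => x; rewrite big_cons Qi.
Qed.

Lemma has_mean_ae f g e : measurable_fun [set: T] g ->
  {ae P, forall x, f x = g x} -> has_mean f e -> has_mean g e.
Proof.
move=> mg fg fe; have mf := has_mean_measurable fe.
have [fi fE] := fe.
have mEf : measurable_fun [set: T] (EFin \o f) by exact/measurable_EFinP.
have mEg : measurable_fun [set: T] (EFin \o g) by exact/measurable_EFinP.
split; last first.
  rewrite -fE; apply: ae_eq_integral => //.
  by apply: filterS fg => x fgx _ /=; rewrite fgx.
move: fi => /integrableP[_ foo]; apply/integrableP; split => //.
apply: le_lt_trans foo; rewrite le_eqVlt; apply/orP; left; apply/eqP.
apply: ae_eq_integral => //; try exact: measurableT_comp.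
by apply: filterS fg => x fgx _ /=; rewrite fgx.
Qed.

Lemma has_mean_le f g a b : has_mean f a -> has_mean g b ->
  (forall x, f x <= g x) -> a <= b.
Proof.
move=> [fi fE] [gi gE] fg; rewrite -lee_fin -fE -gE; apply: le_integral => //.
by move=> x _; rewrite lee_fin.
Qed.

Lemma has_mean_dominated (f g : T -> R) b : measurable_fun [set: T] f -> has_mean g b ->
  {ae P, forall x, `|f x| <= g x} -> exists a, has_mean f a.
Proof.
move=> mf [gi gE] fg.
have mEf : measurable_fun [set: T] (EFin \o f) by exact/measurable_EFinP.
(* Dominated convergence is applied to a constant sequence, for its integrability conclusion under
   an almost sure bound. *)
have cf : {ae P, forall x, [set: T] x ->
    (fun _ : nat => (EFin \o f) x) @ \oo --> (EFin \o f) x}.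
  by apply: aeW => x _; exact: cvg_cst.
have bf : {ae P, forall x (n : nat), [set: T] x -> (`|(EFin \o f) x| <= (EFin \o g) x)%E}.
  by apply: filterS fg => x fgx _ _; rewrite /= lee_fin.
have [fi _ _] := dominated_convergence measurableT (fun=> mEf) mEf cf gi bf.
by exists (fine (\int[P]_x (f x)%:E)%E); exact: integrable_has_mean.
Qed.

Lemma markov_has_mean (f : T -> R) (e c : R) : 0 < c -> (forall x, 0 <= f x) -> has_mean f e ->
  (P [set x | c <= f x]%R <= (e / c)%:E)%E.
Proof.
move=> c_gt0 f_ge0 fe; have mf := has_mean_measurable fe.
have [_ fE] := fe.
pose F : {RV P >-> R} := mfun_Sub (mem_set mf).
have EF : expectation P ((id \o (fun x : R => `|x|)) \o F) = e%:E.
  by rewrite unlock -fE; apply: eq_integral => x _ /=; rewrite ger0_norm.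
have := @markov _ _ _ P F id c c_gt0 (@measurable_id _ _ _) (fun r h => h)
  (fun x y _ _ h => h).
rewrite EF -lee_pdivlMl // -EFinM mulrC; apply: le_trans.
rewrite le_eqVlt; apply/orP; left; apply/eqP; congr (P _).
by apply/seteqP; split=> x /=; rewrite lee_fin ger0_norm.
Qed.

(** The product rule on rectangles identifies the joint law with the product of the marginal laws;
    Fubini's theorem then factors the integral. *)
Lemma has_meanM_independent (A B : T -> R) a b :
  (forall U V, measurable U -> measurable V ->
    P (A @^-1` U `&` B @^-1` V) = (P (A @^-1` U) * P (B @^-1` V))%E) ->
  has_mean A a -> has_mean B b -> has_mean (fun x => A x * B x) (a * b).
Proof.
move=> indAB Aa Bb; have mA := has_mean_measurable Aa.
have mB := has_mean_measurable Bb.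
pose F : {RV P >-> R} := mfun_Sub (mem_set mA).
pose G : {RV P >-> R} := mfun_Sub (mem_set mB).
have mAB := measurable_fun_pair mA mB.
pose J : {mfun T >-> (R * R)%type} := mfun_Sub (mem_set mAB).
pose mF := distribution P F; pose mG := distribution P G.
have joint X : measurable X -> (mF \x mG)%E X = distribution P J X.
  apply: product_measure_unique => U V mU mV.
  exact: indAB.
pose f (z : R * R) := (z.1 * z.2)%:E.
have mf : measurable_fun [set: R * R] f.
  apply/measurable_EFinP; apply: measurable_funM.
    exact: measurable_fst.
  exact: measurable_snd.
have [Ai AE] := Aa; have [Bi BE] := Bb.
have mid : measurable_fun [set: R] (fun y : R => y%:E) by exact/measurable_EFinP.
have mabs : measurable_fun [set: R] (fun y : R => `|y%:E|%E).
  exact: measurableT_comp.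
have mG_int : mG.-integrable [set: R] (fun y : R => y%:E).
  by apply: (integrable_pushforward (f := EFin) _ mid).
have mF_int : mF.-integrable [set: R] (fun y : R => y%:E).
  by apply: (integrable_pushforward (f := EFin) _ mid).
have mGE : (\int[mG]_y y%:E = b%:E)%E.
  by rewrite -BE integral_distribution.
have mFE : (\int[mF]_y y%:E = a%:E)%E.
  by rewrite -AE integral_distribution.
have f_int : (mF \x mG)%E.-integrable [set: R * R] f.
  apply/integrable12ltyP => //.
  have inner x : (\int[mG]_y `|f (x, y)| =
      `|x%:E| * \int[mG]_y `|y%:E|)%E.
    rewrite -ge0_integralZl //; apply: eq_integral => y _.
    by rewrite -abseM -EFinM.
  under eq_integral do rewrite inner.
  rewrite ge0_integralZr //; last exact: integral_ge0.
  move: mF_int mG_int => /integrableP[_ Foo] /integrableP[_ Goo].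
  by apply: lte_mul_pinfty => //; rewrite ?integral_ge0 // ge0_fin_numE // integral_ge0.
have fJ : P.-integrable [set: T] (f \o J).
  apply/integrableP; split; first exact: measurableT_comp.
  have mabsf : measurable_fun [set: R * R] (abse \o f) by exact: measurableT_comp.
  have := ge0_integral_distribution J mabsf (fun=> abse_ge0 _).
  move=> /= <-.
  move: f_int => /integrableP[_]; rewrite (@eq_measure_integral _ _ _ _ (distribution P J)) //.
  by move=> U mU _; exact: joint.
split.
  by apply: eq_integrable fJ.
transitivity (\int[distribution P J]_z f z)%E.
  by rewrite integral_distribution //.
transitivity (\int[(mF \x mG)%E]_z f z)%E.
  by apply: eq_measure_integral => U mU _; exact: esym (joint _ mU).
rewrite -integral12_prod_meas1 // /fubini_F.
have inner x : (\int[mG]_y f (x, y) = x%:E * b%:E)%E.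
  by rewrite -mGE -integralZl.
under eq_integral do rewrite inner.
by rewrite integralZr // mFE.
Qed.

End HasMean.

(** * Transport between equal laws; testing against bounded functions *)

Section Transfer.
Context {R : realType} {d d' : measure_display} {T : measurableType d}
  {T' : measurableType d'} (P : probability T R).

Lemma has_mean_same_distribution (Z W : T -> T') (phi : T' -> R) e :
  measurable_fun [set: T] Z -> measurable_fun [set: T] W ->
  measurable_fun [set: T'] phi -> same_distribution P Z W ->
  has_mean P (fun t => phi (W t)) e -> has_mean P (fun t => phi (Z t)) e.
Proof.
move=> mZ mW mphi ZW [Wi WE].
pose F : {mfun T >-> T'} := mfun_Sub (mem_set mZ).
pose G : {mfun T >-> T'} := mfun_Sub (mem_set mW).
have FG U : measurable U -> distribution P F U = distribution P G U.
  by move=> mU; exact: ZW.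
have mEphi : measurable_fun [set: T'] (EFin \o phi) by exact/measurable_EFinP.
have mabs : measurable_fun [set: T'] (abse \o (EFin \o phi)).
  exact: measurableT_comp.
have Zi : P.-integrable [set: T] ((EFin \o phi) \o F).
  apply/integrableP; split; first exact: measurableT_comp.
  have := ge0_integral_distribution F mabs (fun=> abse_ge0 _).
  move=> /= <-.
  rewrite (@eq_measure_integral _ _ _ _ (distribution P G)); last first.
    by move=> U mU _; exact: FG.
  rewrite (ge0_integral_distribution G mabs (fun=> abse_ge0 _)).
  by move: Wi => /integrableP[].
split; first exact: Zi.
rewrite -WE; transitivity (\int[distribution P F]_y (EFin \o phi) y)%E.
  by rewrite integral_distribution.
transitivity (\int[distribution P G]_y (EFin \o phi) y)%E.
  by apply: eq_measure_integral => U mU _; exact: FG.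
by rewrite integral_distribution.
Qed.

Lemma ae_same_distribution (Z W : T -> T') (B : set T') :
  measurable_fun [set: T] Z -> measurable_fun [set: T] W ->
  measurable B -> same_distribution P Z W ->
  {ae P, forall t, B (W t)} -> {ae P, forall t, B (Z t)}.
Proof.
move=> mZ mW mB ZW [N [mN N0 WN]].
have mCB : measurable (~` B) by exact: measurableC.
exists (Z @^-1` (~` B)); split => //.
  by rewrite -[X in measurable X]setTI; exact: mZ.
apply/eqP; rewrite eq_le measure_ge0 andbT; have := ZW _ mCB => /= ->.
rewrite -N0; apply: le_measure; rewrite ?inE //.
by rewrite -[X in measurable X]setTI; exact: mW.
Qed.

Import HBNNSimple.

(* The defining property of conditional expectations, extended from
   indicators to bounded functions of the conditioning variable. *)
Lemma has_mean_bounded_test (Z : T -> T') (D : T -> R) (phi : T' -> R) (C : R) :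
  measurable_fun [set: T] Z -> P.-integrable [set: T] (EFin \o D) ->
  (forall B, measurable B -> (\int[P]_(t in Z @^-1` B) (D t)%:E = 0)%E) ->
  measurable_fun [set: T'] phi -> (forall x, `|phi x| <= C) ->
  has_mean P (fun t => D t * phi (Z t)) 0.
Proof.
(* Adding [C] makes [phi] nonnegative, as approximation by simple functions requires; the correction
   [D t * C] has mean 0 by the case B = [setT]. *)
move=> mZ Di D0; move: phi; suff nonneg : forall phi : T' -> R, measurable_fun [set: T'] phi ->
    (forall x, 0 <= phi x <= C + C) -> has_mean P (fun t => D t * phi (Z t)) 0.
  move=> phi mphi phiC.
  have h1 : has_mean P (fun t => D t * (phi (Z t) + C)) 0.
    apply: (nonneg (fun x => phi x + C)).
      exact: measurable_funD.
    by move=> x; have := phiC x; rewrite ler_norml => /andP[? ?]; apply/andP; split; lra.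
  have h2 : has_mean P (fun t => D t * C) 0.
    have : has_mean P D 0.
      by split => //; exact: D0 setT measurableT.
    by move/(has_meanZ C); rewrite mulr0; apply: has_mean_eq => t; rewrite mulrC.
  have := has_meanB h1 h2; rewrite subr0; apply: has_mean_eq => t; ring.
move=> phi mphi phi_bd.
have phi_ge0 x : 0 <= phi x by have /andP[] := phi_bd x.
have phi_le x : phi x <= C + C by have /andP[] := phi_bd x.
have mD : measurable_fun [set: T] D by exact/measurable_EFinP/(measurable_int P).
have indic B : measurable B -> has_mean P (fun t => D t * \1_B (Z t)) 0.
  move=> mB; have mZB : measurable (Z @^-1` B).
    by rewrite -[X in measurable X]setTI; exact: mZ.
  have E t : ((EFin \o D) \_ (Z @^-1` B)) t = (D t * \1_B (Z t))%:E.
    rewrite patchE indicE; have -> : (t \in Z @^-1` B) = (Z t \in B).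
      by apply/idP/idP; rewrite !inE.
    by case: ifP; rewrite ?mulr1 ?mulr0.
  split; last first.
    by under eq_integral do rewrite -E; rewrite -integral_mkcond D0.
  have : P.-integrable [set: T] ((EFin \o D) \_ (Z @^-1` B)).
    by apply/(integrable_mkcond _ mZB); exact: (integrableS measurableT).
  by apply: eq_integrable => // t _; rewrite E.
have mEphi : measurable_fun [set: T'] (EFin \o phi) by exact/measurable_EFinP.
pose h := nnsfun_approx measurableT mEphi.
have h_le n x : h n x <= phi x.
  rewrite -lee_fin /h nnsfun_approxE.
  by apply: (@le_approx _ _ _ setT (EFin \o phi)) => // y _; rewrite lee_fin.
have simple n : has_mean P (fun t => D t * h n (Z t)) 0.
  have := @has_mean_sum _ _ _ P _ (finmap.enum_fset (fset_set (range (h n)))) predT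
    (fun y t => y * (D t * \1_(h n @^-1` [set y]) (Z t))) (fun=> 0).
  rewrite big1 //.
  set f := (fun x => \sum_(_ <- _ | _) _); move=> H.
  apply: (@has_mean_eq _ _ _ _ f).
    move=> t; rewrite /f (fimfunE (h n)) fsbig_finite //= mulr_sumr.
    by apply: eq_bigr => y _; ring.
  apply: H => y _; rewrite -(mulr0 y); apply: has_meanZ; apply: indic.
  exact: measurable_sfunP.
have mphiZ : measurable_fun [set: T] (fun t => phi (Z t)) by exact: measurableT_comp.
have mlim : measurable_fun [set: T] (fun t => (D t * phi (Z t))%:E).
  by apply/measurable_EFinP; exact: measurable_funM.
have mseq n : measurable_fun [set: T] (fun t => (D t * h n (Z t))%:E).
  by apply/measurable_EFinP; exact: has_mean_measurable (simple n).
have cv : {ae P, forall t, [set: T] t ->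
    (fun n => (D t * h n (Z t))%:E) @ \oo --> (D t * phi (Z t))%:E}.
  apply: aeW => t _; rewrite EFinM.
  under eq_fun do rewrite EFinM.
  apply: cvgeZl => //.
  exact: (cvg_nnsfun_approx measurableT mEphi (fun y _ => phi_ge0 y)).
pose G t := (C + C) * `|D t|.
have gi : P.-integrable [set: T] (EFin \o G).
  by have [] := has_meanZ (C + C) (integrable_has_mean (integrable_norm Di)).
have bd : {ae P, forall t n, [set: T] t ->
    (`|(D t * h n (Z t))%:E| <= (EFin \o G) t)%E}.
  apply: aeW => t n _; rewrite /= lee_fin normrM mulrC ler_wpM2r //.
  rewrite ger0_norm //; exact: le_trans (h_le _ _) (phi_le _).
have [fi _ fE] := dominated_convergence measurableT mseq mlim cv gi bd.
split; first exact: fi.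
have E0 : (fun n => (\int[P]_t (D t * h n (Z t))%:E)%E) = fun=> 0%E.
  by apply/funext => n; have [_ ->] := simple n.
move: fE; rewrite /mk_sequence E0 => fE.
exact: (cvg_unique (@ereal_hausdorff R) fE (cvg_cst _)).
Qed.

End Transfer.

(** * Second moments of i.i.d. sums *)

Section Sums.
Context {R : realType} {d d' : measure_display} {T : measurableType d}
  {T' : measurableType d'} (P : probability T R).

(** In the double sum the off-diagonal terms vanish by independence and centring, and each of the n
    diagonal terms has mean [c]. It serves both the Gram matrix entries and the score vector. *)
Lemma has_mean_sumM_iid n (Z : 'I_n -> T -> T') (Z0 : T -> T') (f g : T' -> R) c :
  (forall i, measurable_fun [set: T] (Z i)) -> measurable_fun [set: T] Z0 ->
  measurable_fun [set: T'] f -> measurable_fun [set: T'] g ->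
  mutually_independent P Z -> (forall i, same_distribution P (Z i) Z0) ->
  has_mean P (fun t => f (Z0 t)) 0 -> has_mean P (fun t => g (Z0 t)) 0 ->
  has_mean P (fun t => f (Z0 t) * g (Z0 t)) c ->
  has_mean P (fun t => (\sum_i f (Z i t)) * (\sum_i g (Z i t))) (n%:R * c).
Proof.
move=> mZ mZ0 mf mg indZ distZ f0 g0 fg.
have fi i := has_mean_same_distribution (mZ i) mZ0 mf (distZ i) f0.
have gi i := has_mean_same_distribution (mZ i) mZ0 mg (distZ i) g0.
have fgi i : has_mean P (fun t => f (Z i t) * g (Z i t)) c.
  exact: (has_mean_same_distribution (mZ i) mZ0 (measurable_funM mf mg) (distZ i) fg).
have fgij i j : i != j -> has_mean P (fun t => f (Z i t) * g (Z j t)) 0.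
  move=> ij; rewrite -(mulr0 (0 : R)); apply: has_meanM_independent => // U V mU mV.
  have mfU : measurable (f @^-1` U) by rewrite -[X in measurable X]setTI; exact: mf.
  have mgV : measurable (g @^-1` V) by rewrite -[X in measurable X]setTI; exact: mg.
  have := indZ [set i; j]%SET (fun k => if k == i then f @^-1` U else g @^-1` V).
  rewrite big_setU1 ?inE //= big_set1 eqxx eq_sym (negbTE ij).
  move=> H; rewrite -[RHS]H; last by move=> k _; case: ifP.
  congr (P _); apply/seteqP; split => t /=.
    by move=> [Ut Vt] k; rewrite !inE => /orP[]/eqP ->; rewrite ?eqxx // eq_sym (negbTE ij).
  move=> H'; split.
    by have := H' i; rewrite !inE eqxx /= => /(_ isT).
  by have := H' j; rewrite !inE eqxx orbT eq_sym (negbTE ij) => /(_ isT).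
have -> : n%:R * c = \sum_(i < n) \sum_(j < n) (if i == j then c else 0).
  rewrite -[n in LHS]card_ord -sum1_card natr_sum mulr_suml; apply: eq_bigr => i _.
  rewrite mul1r (bigD1 i) //= eqxx big1 ?addr0 // => j.
  by rewrite eq_sym => /negbTE ->.
apply: (@has_mean_eq _ _ _ _ (fun t => \sum_i \sum_j f (Z i t) * g (Z j t))).
  move=> t; rewrite mulr_suml; apply: eq_bigr => i _.
  by rewrite mulr_sumr.
apply: has_mean_sum => i _; apply: has_mean_sum => j _.
by case: eqVneq => [<-|ij]; [exact: fgi|exact: fgij].
Qed.

End Sums.

(** * Consequences of the conditional moment assumptions *)

Section CondExpectation.
Context {R : realType} {d d' : measure_display} {T : measurableType d}
  {T' : measurableType d'} (P : probability T R).

(** Multiplying [phi] by the indicator of the set where the bound holds makes it bounded everywhere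
    and changes the integrand only on a null set. *)
Lemma has_mean_bounded_test_ae (Z : T -> T') (D : T -> R) (phi : T' -> R) (C : R) :
  0 <= C -> measurable_fun [set: T] Z -> P.-integrable [set: T] (EFin \o D) ->
  (forall B, measurable B -> (\int[P]_(t in Z @^-1` B) (D t)%:E = 0)%E) ->
  measurable_fun [set: T'] phi -> {ae P, forall t, `|phi (Z t)| <= C} ->
  has_mean P (fun t => D t * phi (Z t)) 0.
Proof.
move=> C_ge0 mZ Di D0 mphi phiC.
pose A := [set x | `|phi x| <= C].
have mA : measurable A.
  rewrite -[A]setTI; apply: measurable_fun_le => //.
  exact: measurableT_comp.
apply: (@has_mean_ae _ _ _ _ (fun t => D t * (phi (Z t) * \1_A (Z t)))).
- apply: measurable_funM; first exact/measurable_EFinP/(measurable_int P).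
  exact: measurableT_comp.
- by apply: filterS phiC => t ht; rewrite indicE mem_set // mulr1.
- apply: (has_mean_bounded_test (phi := fun x => phi x * \1_A x) (C := C)) => //.
    exact: measurable_funM.
  move=> x; rewrite indicE; case: (boolP (x \in A)) => [/set_mem //|_].
    by rewrite mulr1.
  by rewrite mulr0 normr0.
Qed.

(** The conditional variance is taken about some version g of the conditional mean. The sets {g > 0}
    and {g < 0} are events of the conditioning sigma-algebra over which g integrates to 0, so g = 0
    almost surely. *)
Lemma cond_variance_of_centered (Z : T -> T') (Y : T -> R) (v : R) :
  measurable_fun [set: T] Z -> is_cond_expectation P Z Y (fun=> 0) ->
  is_cond_variance P Z Y (fun=> v) ->
  has_mean P (fun t => Y t ^+ 2) v /\
  (forall B, measurable B -> (\int[P]_(t in Z @^-1` B) (Y t ^+ 2 - v)%:E = 0)%E).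
Proof.
move=> mZ [Yi _ _ Y0] [g [_ mg gi gY] [Vi _ _ VY]].
have mY : measurable_fun [set: T] Y by exact/measurable_EFinP/(measurable_int P).
have mgT : measurable_fun [set: T] g by exact/measurable_EFinP/(measurable_int P).
have gint A : g_sigma_algebra_preimage Z A -> (\int[P]_(t in A) (g t)%:E = 0)%E.
  by move=> mA; rewrite gY // -Y0 // integral0.
have g_ae0 : {ae P, forall t, g t = 0}.
  have sgn (s : R) : {ae P, forall t, s * g t <= 0}.
    pose sg t := s * g t.
    pose A := [set t | 0 < sg t].
    have mA : g_sigma_algebra_preimage Z A.
      have msg : measurable_fun [set: g_sigma_algebra_preimageType Z] sg.
        exact: measurable_funM.
      have := msg measurableT `]0%R, +oo[%classic (measurable_itv _).
      rewrite setTI (_ : _ @^-1` _ = A) //; apply/seteqP; split => t /=;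
        by rewrite in_itv /= andbT.
    have mAT : measurable A by case: mA => B mB <-; exact: mZ.
    have msgA : measurable_fun A (EFin \o sg).
      by apply: measurable_funTS; apply/measurable_EFinP; exact: measurable_funM.
    have giA : P.-integrable A (EFin \o g) by exact: (integrableS measurableT).
    have : (\int[P]_(t in A) `|(EFin \o sg) t| = 0)%E.
      transitivity (\int[P]_(t in A) (s%:E * (EFin \o g) t))%E.
        apply: eq_integral => t /set_mem At /=.
        by rewrite ger0_norm // ltW.
      by rewrite integralZl // gint // mule0.
    move/(ae_eq_integral_abs P mAT msgA); apply: filterS => t /= h.
    rewrite leNgt; apply/negP => At; move: (At); rewrite -/(sg t).
    by have [->] := h At; rewrite ltxx.
  move: (sgn 1) (sgn (-1)); apply: filterS2 => t; rewrite mul1r mulN1r oppr_le0.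
  by move=> g1 g2; apply/le_anti; rewrite g1.
have mY2 : measurable_fun [set: T] (fun t => Y t ^+ 2) by exact: measurable_funX.
have Y2i : has_mean P (fun t => Y t ^+ 2) (fine (\int[P]_t ((Y t - g t) ^+ 2)%:E)).
  apply: (has_mean_ae (f := fun t => (Y t - g t) ^+ 2)) => //.
    by apply: filterS g_ae0 => t ->; rewrite subr0.
  exact: integrable_has_mean.
have Y2A A : g_sigma_algebra_preimage Z A ->
    (\int[P]_(t in A) (Y t ^+ 2)%:E = \int[P]_(t in A) v%:E)%E.
  move=> mA; rewrite VY //.
  have mAT : measurable A by case: mA => B mB <-; exact: mZ.
  apply: ae_eq_integral => //.
  - by apply: measurable_funTS; apply/measurable_EFinP.
  - by apply: measurable_funTS; apply/measurable_EFinP/measurable_funX/measurable_funB.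
  - by apply: filterS g_ae0 => t -> _; rewrite subr0.
have setTZ : g_sigma_algebra_preimage Z setT.
  by exists setT => //; rewrite setTI preimage_setT.
split; first by split; [have [] := Y2i|rewrite Y2A //; have [_ ->] := has_mean_cst P v].
move=> B mB; have mA : g_sigma_algebra_preimage Z (Z @^-1` B).
  by exists B => //; rewrite setTI.
have mAT : measurable (Z @^-1` B) by rewrite -[X in measurable X]setTI; exact: mZ.
have vi : P.-integrable [set: T] (EFin \o (fun=> v)) by have [] := has_mean_cst P v.
under eq_integral do rewrite EFinB.
rewrite (integralB_EFin (f1 := fun t => Y t ^+ 2) (f2 := fun=> v)) //.
- by rewrite Y2A // subee //; apply: integrable_fin_num => //; exact: (integrableS measurableT).
- by apply: (integrableS measurableT) => //; have [] := Y2i.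
- exact: (integrableS measurableT).
Qed.

End CondExpectation.

(** * Probability bound at a fixed sample size *)

Section FixedSampleSize.
Context {R : realType} {d : measure_display} {T : measurableType d}
  (P : probability T R) (n p : nat) (sigma M : R)
  (X : 'I_n -> {RV P >-> p.-tuple R}) (eps : 'I_n -> {RV P >-> R})
  (X0 : {RV P >-> p.-tuple R}) (eps0 : {RV P >-> R})
  (n_gt0 : (0 < n)%N)
  (X_bounded : {ae P, forall t, forall j, `|tnth (X0 t) j| <= M})
  (indep : mutually_independent P (fun i t => (X i t, eps i t)))
  (ident : forall i, same_distribution P (fun t => (X i t, eps i t))
                                         (fun t => (X0 t, eps0 t)))
  (X_mean : forall i j, ('E_P[fun t => tnth (X i t) j] = 0)%E)
  (X_var : forall i j, ('V_P[fun t => tnth (X i t) j] = 1)%E)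
  (eps_mean : is_cond_expectation P X0 eps0 (fun=> 0))
  (eps_var : is_cond_variance P X0 eps0 (fun=> sigma ^+ 2)).

Let S := second_moment_mx P (fun t => col_of (X0 t)).
Let design t : 'M[R]_(n, p) := \matrix_(i, j) tnth (X i t) j.
Let noise t : 'cV[R]_n := \col_i eps i t.
Let obs i t := (X i t, eps i t).
Let obs0 t := (X0 t, eps0 t).

Lemma measurable_coord (Z : {RV P >-> p.-tuple R}) j :
  measurable_fun [set: T] (fun t => tnth (Z t) j).
Proof. exact: (measurableT_comp (measurable_tnth j)). Qed.

Lemma measurable_zero_coords (Z : {RV P >-> p.-tuple R}) (Q : set 'I_p) :
  measurable [set t | (forall j, Q j -> tnth (Z t) j = 0)%R].
Proof.
rewrite (_ : [set t | _] =
    \bigcap_(j in Q) ((fun t => tnth (Z t) j) @^-1` [set 0])); last first.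
  by apply/seteqP; split => t /= h j; exact: h.
apply: fin_bigcap_measurable => // j _.
by rewrite -[X in measurable X]setTI; exact: (measurable_coord Z j).
Qed.

Lemma measurable_obs i : measurable_fun [set: T] (obs i).
Proof. exact: measurable_fun_pair. Qed.

Lemma measurable_obs0 : measurable_fun [set: T] obs0.
Proof. exact: measurable_fun_pair. Qed.

Lemma measurable_fst_tnth j :
  measurable_fun [set: p.-tuple R * R] (fun z => tnth z.1 j).
Proof. exact: (measurableT_comp (measurable_tnth j) measurable_fst). Qed.

Lemma has_mean_ae_bounded (f : T -> R) (C : R) : measurable_fun [set: T] f ->
  {ae P, forall t, `|f t| <= C} -> exists a, has_mean P f a.
Proof. by move=> mf fC; exact: has_mean_dominated mf (has_mean_cst P C) fC. Qed.

Lemma coordM_bounded j l :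
  {ae P, forall t, `|tnth (X0 t) j * tnth (X0 t) l| <= M ^+ 2}.
Proof. by apply: filterS X_bounded => t bt; rewrite normrM expr2 ler_pM. Qed.

Lemma second_moment_has_mean j l :
  has_mean P (fun t => tnth (X0 t) j * tnth (X0 t) l) (S j l).
Proof.
have mjl := measurable_funM (measurable_coord X0 j) (measurable_coord X0 l).
have [s /[dup] hs [_ sE]] := has_mean_ae_bounded mjl (coordM_bounded j l).
suff -> : S j l = s by [].
rewrite /S mxE unlock -[s]/(fine s%:E) -sE; congr fine.
apply: eq_integral => t _; congr EFin.
by rewrite mxE big_ord1 !mxE.
Qed.

Lemma second_moment_sym : S^T = S.
Proof.
apply/matrixP => j l; rewrite mxE.
apply: has_mean_uniq (second_moment_has_mean j l).
by apply: has_mean_eq (second_moment_has_mean l j) => t; rewrite mulrC.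
Qed.

(** Unit variance is assumed for the observations, so an index in ['I_n] is chosen and equality in
    law carries the value to [X0]. *)
Lemma second_moment_diag j : S j j = 1.
Proof.
have i0 : 'I_n := Ordinal n_gt0.
have h : has_mean P (fun t => tnth (X i0 t) j * tnth (X i0 t) j) (S j j).
  exact: (has_mean_same_distribution (measurable_obs i0) measurable_obs0
    (measurable_funM (measurable_fst_tnth j) (measurable_fst_tnth j))
    (ident i0) (second_moment_has_mean j j)).
have := X_var i0 j; rewrite /variance unlock X_mean unlock /=.
move=> H; have [_ hE] := h; apply: EFin_inj; rewrite -hE -H.
apply: eq_integral => t _; congr EFin.
by rewrite -[in LHS](subr0 (tnth (X i0 t) j)).
Qed.

Let covdev j l (z : p.-tuple R * R) := tnth z.1 j * tnth z.1 l - S j l.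

Lemma measurable_covdev j l : measurable_fun [set: p.-tuple R * R] (covdev j l).
Proof.
apply: measurable_funB => //.
exact: measurable_funM (measurable_fst_tnth j) (measurable_fst_tnth l).
Qed.

Lemma covdev_moments j l : exists2 v, v <= M ^+ 4 &
  has_mean P (fun t => (\sum_i covdev j l (obs i t)) ^+ 2) (n%:R * v).
Proof.
have mjl := measurable_funM (measurable_coord X0 j) (measurable_coord X0 l).
have Hs := second_moment_has_mean j l.
have [q hq] : exists q, has_mean P
    (fun t => (tnth (X0 t) j * tnth (X0 t) l) ^+ 2) q.
  apply: (@has_mean_ae_bounded _ ((M ^+ 2) ^+ 2)); first exact: measurable_funX.
  by apply: filterS (coordM_bounded j l) => t h; rewrite normrX lerXn2r ?nnegrE // (le_trans _ h).
(* The bound holds only almost surely, while [has_mean_le] compares pointwise; truncating at M^4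
   bridges this. *)
have q_le : q <= M ^+ 4.
  pose g t := Num.min ((tnth (X0 t) j * tnth (X0 t) l) ^+ 2) (M ^+ 4).
  have hg : has_mean P g q.
    apply: has_mean_ae hq.
      by apply: measurable_minr => //; exact: measurable_funX.
    apply: filterS (coordM_bounded j l) => t h; rewrite /g min_l //.
    rewrite -[X in X <= _]ger0_norm ?sqr_ge0 // normrX.
    have -> : M ^+ 4 = (M ^+ 2) ^+ 2 by rewrite -exprM.
    by rewrite lerXn2r ?nnegrE // (le_trans _ h).
  apply: (has_mean_le hg (has_mean_cst P _)) => t.
  by rewrite /g ge_min lexx orbT.
exists (q - S j l ^+ 2); first by have := sqr_ge0 (S j l); lra.
have c0 : has_mean P (fun t => covdev j l (obs0 t)) 0.
  have := has_meanB Hs (has_mean_cst P (S j l)); rewrite subrr.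
  exact: has_mean_eq.
have c2 : has_mean P (fun t => covdev j l (obs0 t) * covdev j l (obs0 t)) (q - S j l ^+ 2).
  have := has_meanB hq (has_meanB (has_meanZ (2 * S j l) Hs) (has_mean_cst P (S j l ^+ 2))).
  have -> : q - (2 * S j l * S j l - S j l ^+ 2) = q - S j l ^+ 2 by ring.
  by apply: has_mean_eq => t; rewrite /covdev /=; ring.
have := has_mean_sumM_iid measurable_obs measurable_obs0 (measurable_covdev j l)
  (measurable_covdev j l) indep ident c0 c0 c2.
by apply: has_mean_eq => t; rewrite expr2.
Qed.

Let frob t := \sum_j \sum_l (n%:R^-1 * ((design t)^T *m design t) j l - S j l) ^+ 2.

(** Each of the p^2 entries is an average of n centred i.i.d. terms, so its mean square is a single
    variance over n. *)
Lemma frob_has_mean : exists2 v, v <= p%:R ^+ 2 * M ^+ 4 / n%:R & has_mean P frob v.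
Proof.
have nR : 0 < n%:R :> R by rewrite ltr0n.
have [v v_le hv] : exists2 v : 'I_p -> 'I_p -> R, forall j l, v j l <= M ^+ 4 &
    forall j l, has_mean P (fun t => (\sum_i covdev j l (obs i t)) ^+ 2) (n%:R * v j l).
  have /choice[v hv] : forall jl : 'I_p * 'I_p, exists v, v <= M ^+ 4 /\
     has_mean P (fun t => (\sum_i covdev jl.1 jl.2 (obs i t)) ^+ 2) (n%:R * v).
    by move=> [j l]; have [v ? ?] := covdev_moments j l; exists v.
  by exists (fun j l => v (j, l)) => j l; have [] := hv (j, l).
exists (\sum_j \sum_l n%:R^-1 ^+ 2 * (n%:R * v j l)).
  apply: (@le_trans _ _ (\sum_(j < p) \sum_(l < p) M ^+ 4 / n%:R)).
    apply: ler_sum => j _; apply: ler_sum => l _.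
    have -> : n%:R^-1 ^+ 2 * (n%:R * v j l) = v j l / n%:R by field; rewrite gt_eqF.
    by rewrite ler_pM2r ?invr_gt0.
  rewrite !sumr_const !card_ord -mulrnA -[X in X <= _]mulr_natr natrM.
  by rewrite le_eqVlt; apply/orP; left; apply/eqP; ring.
apply: (@has_mean_eq _ _ _ _ (fun t => \sum_j \sum_l
    n%:R^-1 ^+ 2 * (\sum_i covdev j l (obs i t)) ^+ 2)).
  move=> t; apply: eq_bigr => j _; apply: eq_bigr => l _.
  rewrite -exprMn; congr (_ ^+ 2).
  rewrite sumrB sumr_const card_ord mulrBr -[X in _ - _ * X]mulr_natl mulKf ?gt_eqF //.
  congr (_ * _ - _); rewrite mxE; apply: eq_bigr => i _.
  by rewrite !mxE.
by apply: has_mean_sum => j _; apply: has_mean_sum => l _; apply: has_meanZ.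
Qed.

Let score j (z : p.-tuple R * R) := tnth z.1 j * z.2.

Lemma measurable_score j : measurable_fun [set: p.-tuple R * R] (score j).
Proof. exact: measurable_funM (measurable_fst_tnth j) measurable_snd. Qed.

Lemma score_centered j : has_mean P (fun t => score j (obs0 t)) 0.
Proof.
have [eps_int _ _ eps0E] := eps_mean.
have D0 B : measurable B -> (\int[P]_(t in X0 @^-1` B) (eps0 t)%:E = 0)%E.
  by move=> mB; rewrite -eps0E ?integral0 //; exists B => //; rewrite setTI.
have bd : {ae P, forall t, `|tnth (X0 t) j| <= `|M|}.
  by apply: filterS X_bounded => t bt; rewrite (le_trans (bt j)) // ler_norm.
have := has_mean_bounded_test_ae (normr_ge0 M) (measurable_funP X0) eps_int D0
  (measurable_tnth j) bd.
by apply: has_mean_eq => t; rewrite /score mulrC.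
Qed.

(** Split eps^2 into sigma^2 and eps^2 - sigma^2; the latter is orthogonal to bounded functions of
    the covariates. *)
Lemma score_covariance j l :
  has_mean P (fun t => score j (obs0 t) * score l (obs0 t)) (sigma ^+ 2 * S j l).
Proof.
have [e2 e20] := cond_variance_of_centered (measurable_funP X0) eps_mean eps_var.
have [Di _] := has_meanB e2 (has_mean_cst P (sigma ^+ 2)).
have H := @has_mean_bounded_test_ae _ _ _ _ _ P X0
  (fun t => eps0 t ^+ 2 - sigma ^+ 2) (fun x => tnth x j * tnth x l) (M ^+ 2)
  (sqr_ge0 _) (measurable_funP X0) Di e20
  (measurable_funM (measurable_tnth j) (measurable_tnth l)) (coordM_bounded j l).
have := has_meanD H (has_meanZ (sigma ^+ 2) (second_moment_has_mean j l)).
by rewrite add0r; apply: has_mean_eq => t; rewrite /score /=; ring.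
Qed.

Let V t := bilin (invmx S) ((design t)^T *m noise t) ((design t)^T *m noise t).

(** The score vector has covariance n sigma^2 S, so the mean is n sigma^2 times the trace of S^-1
    S. *)
Lemma V_has_mean : S \in unitmx -> has_mean P V (n%:R * sigma ^+ 2 * p%:R).
Proof.
move=> Su; have -> : n%:R * sigma ^+ 2 * p%:R =
    \sum_j \sum_l invmx S j l * (n%:R * (sigma ^+ 2 * S j l)).
  rewrite -[p in LHS]card_ord -sum1_card natr_sum mulr_sumr; apply: eq_bigr => j _.
  have : (invmx S *m S) j j = 1 by rewrite mulVmx // mxE eqxx.
  rewrite mxE => tr; transitivity (n%:R * sigma ^+ 2 * \sum_l invmx S j l * S l j).
    by rewrite tr.
  rewrite mulr_sumr; apply: eq_bigr => l _.
  have -> : S l j = S j l by rewrite -[in LHS]second_moment_sym mxE.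
  by ring.
apply: (@has_mean_eq _ _ _ _ (fun t => \sum_j \sum_l invmx S j l *
    ((\sum_i score j (obs i t)) * (\sum_i score l (obs i t))))).
  have E t j : ((design t)^T *m noise t) j 0 = \sum_i score j (obs i t).
    by rewrite mxE; apply: eq_bigr => i _; rewrite !mxE.
  by move=> t; rewrite /V bilin_sum; apply: eq_bigr => j _; apply: eq_bigr => l _; rewrite !E.
apply: has_mean_sum => j _; apply: has_mean_sum => l _; apply: has_meanZ.
exact: has_mean_sumM_iid measurable_obs measurable_obs0 (measurable_score j)
  (measurable_score l) indep ident (score_centered j) (score_centered l) (score_covariance j l).
Qed.

(** The threshold [c] for V is left free. Failure of selection forces a large Frobenius error, V >=
    c, or a null event; Markov's inequality bounds the first two. *)
Lemma selection_probability (beta : 'cV[R]_p) (bhat : {RV P >-> p.-tuple R})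
    (lambda a rho c : R) :
  2 < a -> 0 < lambda -> 0 < rho -> 1 <= M -> 0 < c ->
  (forall u, rho * bilin 1%:M u u <= bilin S u u) ->
  (forall t, is_ls_scad_estimate (design t) (design t *m beta + noise t)
     lambda a (col_of (bhat t))) ->
  (forall j, beta j 0 != 0 -> 2 * a * lambda <= `|beta j 0| /\
     16 * c / (n%:R ^+ 2 * rho) +
     2 * (#|[pred j | beta j 0 != 0]|)%:R * (a + 1) * lambda ^+ 2 / rho
       <= `|beta j 0| ^+ 2 / 4) ->
  (2 + 6 * M + 4 * M ^+ 2) ^+ 2 * c <= n%:R ^+ 2 * lambda ^+ 2 * rho ->
  ((1 - (4 * M ^+ 4 * (p%:R ^+ 2 / (n%:R * rho ^+ 2)) +
         n%:R * sigma ^+ 2 * p%:R / c))%:E <=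
   P [set t | (forall j, beta j 0 = 0 -> tnth (bhat t) j = 0)%R])%E.
Proof.
move=> a2 lambda_gt0 rho_gt0 M1 c_gt0 Srho est beta_big c_small.
have nR : 0 < n%:R :> R by rewrite ltr0n.
have Sunit := posdef_unit rho_gt0 Srho.
have Spsd w : 0 <= bilin S w w.
  by apply: le_trans (Srho w); rewrite mulr_ge0 ?bilin1_ge0 // ltW.
set E := [set t | _].
have mE : measurable E := measurable_zero_coords bhat [set j | beta j 0 = 0].
have Xb : {ae P, forall t, forall i j, `|tnth (X i t) j| <= M}.
  apply: filter_forall => i; apply: filter_forall => j.
  pose B : set (p.-tuple R * R) := [set z | `|tnth z.1 j| <= M].
  have mB : measurable B.
    rewrite -[B]setTI; apply: measurable_fun_le => //.
    by apply: measurableT_comp => //; exact: measurable_fst_tnth.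
  apply: (ae_same_distribution (measurable_obs i) measurable_obs0 mB (ident i)).
  by apply: filterS X_bounded => t; exact.
have [N [mN N0 XN]] := Xb.
have [v v_le hv] := frob_has_mean.
have hV := V_has_mean Sunit.
pose A1 := [set t | rho ^+ 2 / 4 <= frob t]; pose A2 := [set t | c <= V t].
have measurable_ge f e : has_mean P f e -> forall c', measurable [set t | c' <= f t].
  move=> /has_mean_measurable mf c'; rewrite -[X in measurable X]setTI.
  exact: measurable_fun_le.
have mA1 : measurable A1 := measurable_ge _ _ hv _.
have mA2 : measurable A2 := measurable_ge _ _ hV _.
have sub : ~` E `<=` (A1 `|` A2) `|` N.
  move=> t Et; have [tN|tN] := pselect (N t); [by right|left].
  have Xt : forall i j, `|tnth (X i t) j| <= M by apply: contrapT => h; exact/tN/XN.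
  apply: contrapT => /not_orP[/negP/= ]; rewrite -ltNge => frob_lt /negP/=.
  rewrite -ltNge => V_lt; apply: Et => j bj.
  have := @scad_estimate_sparse _ _ _ (design t) S beta (col_of (bhat t)) (noise t)
    lambda a rho M a2 lambda_gt0 rho_gt0 M1 n_gt0 second_moment_sym second_moment_diag Srho.
  rewrite -/(V t) => /(_ _ (ltW frob_lt) (est t)) H.
  have := H _ _ _ j bj; rewrite mxE; apply.
  - by move=> i l; rewrite mxE.
  - move=> l /beta_big[? h]; split=> //; apply: lt_le_trans h.
    by rewrite ltrD2r ltr_pM2r ?invr_gt0 ?mulr_gt0 ?exprn_gt0 // ltr_pM2l.
  - apply: lt_le_trans c_small; rewrite ltr_pM2l // exprn_gt0 //.
    by have := sqr_ge0 M; lra.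
have PA1 : (P A1 <= (4 * M ^+ 4 * (p%:R ^+ 2 / (n%:R * rho ^+ 2)))%:E)%E.
  have frob_ge0 t : 0 <= frob t.
    by rewrite sumr_ge0 // => j _; rewrite sumr_ge0 // => l _; rewrite sqr_ge0.
  have r4 : 0 < rho ^+ 2 / 4 by rewrite divr_gt0 // exprn_gt0.
  apply: le_trans (markov_has_mean r4 frob_ge0 hv) _.
  rewrite lee_fin ler_pdivrMr //; apply: le_trans v_le _.
  by rewrite le_eqVlt; apply/orP; left; apply/eqP; field; rewrite !gt_eqF.
have PA2 : (P A2 <= (n%:R * sigma ^+ 2 * p%:R / c)%:E)%E.
  apply: markov_has_mean => // t; rewrite /V -bilin_invinv //.
  exact: second_moment_sym.
have PCE : (P (~` E) <= P A1 + P A2)%E.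
  apply: (@le_trans _ _ (P (A1 `|` A2 `|` N))).
    apply: le_measure; rewrite ?inE //; first exact: measurableC.
    by do 2! apply: measurableU => //.
  apply: le_trans (measureU2 _ (measurableU _ _ mA1 mA2) mN) _.
  by rewrite [X in (_ + X)%E](_ : _ = 0%E) // adde0; exact: measureU2.
have : (P (~` E) <= (4 * M ^+ 4 * (p%:R ^+ 2 / (n%:R * rho ^+ 2)) +
         n%:R * sigma ^+ 2 * p%:R / c)%:E)%E.
  by apply: le_trans PCE _; rewrite EFinD leeD.
rewrite probability_setC // EFinB leeBlDr ?fin_num_measure // => h.
rewrite leeBlDr // addeC.
exact: h.
Qed.

End FixedSampleSize.

(** * Second-moment matrices and their diagonal blocks *)

Section SecondMoment.
Context {R : realType} {d : measure_display} {T : measurableType d}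
  (P : probability T R).

Lemma second_moment_mxE p (Z : T -> 'cV[R]_p) i j :
  second_moment_mx P Z i j = fine ('E_P[fun t => (Z t i 0 * Z t j 0)%R])%E.
Proof.
rewrite mxE; congr (fine (expectation P _)); apply/funext => t.
by rewrite mxE big_ord1 !mxE.
Qed.

Lemma trmx_second_moment p (Z : T -> 'cV[R]_p) :
  (second_moment_mx P Z)^T = second_moment_mx P Z.
Proof.
apply/matrixP => i j; rewrite mxE !second_moment_mxE; congr (fine (expectation P _)).
by apply/funext => t; rewrite mulrC.
Qed.

(** Any diagonal entry of the full matrix is one of a diagonal block. The maximum matters because an
    empty block has largest eigenvalue 0. *)
Lemma max_largest_eigenvalue_ge1 k m (Z : T -> 'cV[R]_(k + m)) : (0 < k + m)%N ->
  (forall j, second_moment_mx P Z j j = 1) ->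
  1 <= Num.max (largest_eigenvalue (second_moment_mx P (fun t => usubmx (Z t))))
               (largest_eigenvalue (second_moment_mx P (fun t => dsubmx (Z t)))).
Proof.
move=> km Z1; have [j _] : exists j : 'I_(k + m), true by exists (Ordinal km).
rewrite le_max -(Z1 j); case: (split_ordP j) => i ->; apply/orP; [left|right].
  have := largest_eigenvalue_diag i (trmx_second_moment (fun t => usubmx (Z t))).
  apply: le_trans; rewrite !second_moment_mxE le_eqVlt; apply/orP; left; apply/eqP.
  by congr (fine (expectation P _)); apply/funext => t; rewrite !mxE.
have := largest_eigenvalue_diag i (trmx_second_moment (fun t => dsubmx (Z t))).
apply: le_trans; rewrite !second_moment_mxE le_eqVlt; apply/orP; left; apply/eqP.
by congr (fine (expectation P _)); apply/funext => t; rewrite !mxE.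
Qed.

End SecondMoment.

(** * The smallest signal *)

Section MinAbs.
Context {R : realType}.

Lemma min_abs_le p (v : 'cV[R]_p) j : min_abs v <= `|v j 0|.
Proof.
apply: ge_inf; last by exists j.
by exists 0 => _ [i _ <-].
Qed.

Lemma min_abs_gt0 p (v : 'cV[R]_p) : (0 < p)%N -> (forall j, v j 0 != 0) ->
  0 < min_abs v.
Proof.
case: p v => // p v _ v0.
have [i _ imin] := (@Order.TotalTheory.arg_minP _ _ _ ord0 predT (fun i => `|v i 0|) isT).
apply: (@lt_le_trans _ _ `|v i 0|); first by rewrite normr_gt0.
apply: lb_le_inf; first by exists `|v ord0 0|, ord0.
by move=> _ [j _ <-]; exact: imin.
Qed.

End MinAbs.

(** * Passage to the limit *)

Theorem theorem4 (R : realType)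
  (d : nat -> measure_display) (T : forall n, measurableType (d n))
  (P : forall n, probability (T n) R)
  (* p_n = k_n + m_n *)
  (k m : nat -> nat)
  (beta : forall n, 'cV[R]_(k n + m n))
  (lambda : nat -> R) (a sigma M : R)
  (X : forall n, 'I_n -> {RV (P n) >-> (k n + m n).-tuple R})
  (eps : forall n, 'I_n -> {RV (P n) >-> R})
  (Y : forall n, 'I_n -> T n -> R)
  (* a generic copy (X, eps) of the pairs (X_i, eps_i) *)
  (X0 : forall n, {RV (P n) >-> (k n + m n).-tuple R})
  (eps0 : forall n, {RV (P n) >-> R})
  (bhat : forall n, {RV (P n) >-> (k n + m n).-tuple R})
  (rho1 pik omegam : nat -> R)
  (a_gt2 : 2 < a)
  (lambda_gt0 : forall n, 0 < lambda n)
  (beta1_neq0 : forall n (j : 'I_(k n)), usubmx (beta n) j 0 != 0)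
  (beta2_eq0 : forall n, dsubmx (beta n) = 0)
  (model : forall n (i : 'I_n) (t : T n),
    Y n i t = ((col_of (X n i t))^T *m beta n) 0 0 + eps n i t)
  (estimator : forall n (t : T n),
    is_ls_scad_estimate (\matrix_(i, j) tnth (X n i t) j) (\col_i Y n i t)
      (lambda n) a (col_of (bhat n t)))
  (X_bounded : forall n,
    {ae P n, forall t, forall j, `|tnth (X0 n t) j| <= M})
  (* (i) *)
  (indep : forall n,
    mutually_independent (P n) (fun (i : 'I_n) t => (X n i t, eps n i t)))
  (ident : forall n (i : 'I_n),
    same_distribution (P n) (fun t => (X n i t, eps n i t))
                            (fun t => (X0 n t, eps0 n t)))
  (X_mean : forall n (i : 'I_n) j,
    ('E_(P n)[fun t => tnth (X n i t) j] = 0)%E)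
  (X_var : forall n (i : 'I_n) j,
    ('V_(P n)[fun t => tnth (X n i t) j] = 1)%E)
  (eps_mean : forall n,
    is_cond_expectation (P n) (X0 n) (eps0 n) (fun=> 0))
  (eps_var : forall n,
    is_cond_variance (P n) (X0 n) (eps0 n) (fun=> sigma ^+ 2))
  (rho1E : forall n, rho1 n =
    smallest_eigenvalue (second_moment_mx (P n) (fun t => col_of (X0 n t))))
  (pikE : forall n, pik n =
    largest_eigenvalue
      (second_moment_mx (P n) (fun t => usubmx (col_of (X0 n t)))))
  (omegamE : forall n, omegam n =
    largest_eigenvalue
      (second_moment_mx (P n) (fun t => dsubmx (col_of (X0 n t)))))
  (rho1_gt0 : forall n, 0 < rho1 n)
  (* (ii) *)
  (lim_p : (fun n => (k n + m n)%:R ^+ 2 / (n%:R * rho1 n ^+ 2))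
    @ \oo --> (0 : R))
  (lim_klambda : (fun n => (k n)%:R * lambda n ^+ 2 / rho1 n)
    @ \oo --> (0 : R))
  (* (iii) *)
  (lim_beta_p : (fun n => Num.sqrt (k n + m n)%:R /
      (Num.sqrt (n%:R * rho1 n) * min_abs (usubmx (beta n))))
    @ \oo --> (0 : R))
  (lim_beta_lambda : (fun n => lambda n * Num.sqrt (k n)%:R /
      (Num.sqrt (rho1 n) * min_abs (usubmx (beta n))))
    @ \oo --> (0 : R))
  (* (iv) *)
  (lim_eigen : (fun n =>
      Num.sqrt (Num.max (pik n) (omegam n) * (k n + m n)%:R) /
      (Num.sqrt n%:R * rho1 n * lambda n))
    @ \oo --> (0 : R)) :
  (fun n => P n [set t | dsubmx (col_of (bhat n t)) = 0]) @ \oo --> (1%:E : \bar R).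
Proof.
pose M' := Num.max M 1.
have M1 : 1 <= M' by rewrite le_max lexx orbT.
pose S n := second_moment_mx (P n) (fun t => col_of (X0 n t)).
have Srho n u : rho1 n * bilin 1%:M u u <= bilin (S n) u u.
  by rewrite rho1E; exact/smallest_eigenvalue_bilin/trmx_second_moment.
pose mb n := min_abs (usubmx (beta n)).
have sqrt_sqr (x : R) : 0 <= x -> Num.sqrt x ^+ 2 = x by move=> /sqr_sqrtr.
pose C := (2 + 6 * M' + 4 * M' ^+ 2) ^+ 2.
have C_gt0 : 0 < C.
  by rewrite exprn_gt0 //; have := sqr_ge0 M'; have := M1; lra.
pose y n := Num.sqrt (k n + m n)%:R / (Num.sqrt (n%:R * rho1 n) * mb n).
pose z n := Num.sqrt (Num.max (pik n) (omegam n) * (k n + m n)%:R) /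
      (Num.sqrt n%:R * rho1 n * lambda n).
pose x n := lambda n * Num.sqrt (k n)%:R / (Num.sqrt (rho1 n) * mb n).
pose u n := (k n + m n)%:R ^+ 2 / (n%:R * rho1 n ^+ 2).
(* The three terms come from the Gram error (ii), the threshold [ca] (iv) and the threshold [cb]
   (iii). *)
pose B n := 4 * M' ^+ 4 * u n + C * sigma ^+ 2 * z n ^+ 2 + 256 * sigma ^+ 2 * y n ^+ 2.
have B_cvg : (fun n => (1 - B n)%:E) @ \oo --> (1%:E : \bar R).
  apply: cvg_EFin; first by near=> n.
  rewrite -[X in _ --> X]subr0; apply: cvgB; first exact: cvg_cst.
  have sq0 (f : nat -> R) : f @ \oo --> (0 : R) -> (fun n => f n ^+ 2) @ \oo --> (0 : R).
    move=> f0; rewrite -[X in _ --> X](mulr0 (0 : R)).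
    under eq_fun do rewrite expr2.
    exact: cvgM.
  have sc0 (s : R) (f : nat -> R) : f @ \oo --> (0 : R) -> (fun n => s * f n) @ \oo --> (0 : R).
    by move=> f0; rewrite -[X in _ --> X](mulr0 s); apply: cvgM => //; exact: cvg_cst.
  rewrite -[X in _ --> X](addr0 (0 : R)); apply: cvgD; last exact/sc0/sq0.
  rewrite -[X in _ --> X](addr0 (0 : R)); apply: cvgD; last exact/sc0/sq0.
  exact/sc0.
apply: (squeeze_cvge _ B_cvg (cvg_cst _)).
have a1 : 0 < a + 1 by lra.
(* A bound delta on [x n] yields both lambda <= delta min|beta_j|, hence 2 a lambda <= |beta_j|, and
   a plateau term of at most min|beta_j|^2 / 8. *)
have delta_gt0 : 0 < (4 * (a + 1))^-1 by rewrite invr_gt0 mulr_gt0.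
have eventE n : [set t | dsubmx (col_of (bhat n t)) = 0] =
    [set t | forall j, beta n j 0 = 0 -> tnth (bhat n t) j = 0].
  have b2 i : beta n (rshift (k n) i) 0 = 0.
    by have /matrixP /(_ i 0) := beta2_eq0 n; rewrite !mxE.
  apply/seteqP; split => t /= h.
    move=> j; case: (split_ordP j) => i ->.
      by have := beta1_neq0 n i; rewrite mxE => /eqP.
    by move/matrixP/(_ i 0) : h; rewrite !mxE.
  by apply/colP => i; rewrite !mxE; apply: h.
near=> n; rewrite eventE; apply/andP; split; last first.
  apply: probability_le1; exact: (measurable_zero_coords (bhat n) [set j | beta n j 0 = 0]).
have n_gt0 : (0 < n)%N by near: n; exact: nbhs_infty_gt.
have x_small : `|x n| <= (4 * (a + 1))^-1.
  near: n; move/cvgrPdist_le : lim_beta_lambda => /(_ _ delta_gt0).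
  by apply: filterS => n; rewrite sub0r normrN.
have nR : 0 < n%:R :> R by rewrite ltr0n.
have rho_gt0 := rho1_gt0 n; have l_gt0 := lambda_gt0 n.
have Xb : {ae P n, forall t, forall j, `|tnth (X0 n t) j| <= M'}.
  by apply: filterS (X_bounded n) => t h j; rewrite le_max h.
have Sdiag j : S n j j = 1.
  exact: (second_moment_diag n_gt0 Xb (ident n) (X_mean n) (X_var n) j).
have card_k : (#|[pred j | (beta n j 0 != 0)%R]| <= k n)%N.
  rewrite -[X in (_ <= X)%N]card_ord -(card_codom (@lshift_inj (k n) (m n))).
  apply: subset_leq_card; apply/fintype.subsetP => j; rewrite inE.
  case: (split_ordP j) => i -> bi; first exact: codom_f.
  by have /matrixP /(_ i 0) := beta2_eq0 n; rewrite !mxE => b0; rewrite b0 eqxx in bi.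
(* [ca] is the largest threshold allowed by the final contradiction; [cb] makes 16 c / (n^2 rho_1)
   at most min|beta_j|^2 / 16. Without signals [mb n] and [cb] are 0, so the minimum is taken only
   when [k n] is positive. *)
pose ca := n%:R ^+ 2 * lambda n ^+ 2 * rho1 n / C.
pose cb := n%:R ^+ 2 * rho1 n * mb n ^+ 2 / 256.
pose c := if (0 < k n)%N then Num.min ca cb else ca.
have ca_gt0 : 0 < ca by rewrite divr_gt0 // !mulr_gt0 ?exprn_gt0.
have mb_gt0 : (0 < k n)%N -> 0 < mb n.
  by move=> k_gt0; apply: min_abs_gt0 => // j; exact: beta1_neq0.
have cb_gt0 : (0 < k n)%N -> 0 < cb.
  by move=> /mb_gt0 h; rewrite divr_gt0 // !mulr_gt0 ?exprn_gt0.
have c_gt0 : 0 < c.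
  by rewrite /c; case: ifP => // /cb_gt0 h; rewrite lt_min ca_gt0.
(* Splits the Markov bound for V into one term per threshold; for [k n] = 0 the inverse of [cb] is
   0. *)
have c_inv : c^-1 <= ca^-1 + cb^-1.
  rewrite /c; case: ifP => [/cb_gt0 cb0|/negbT].
    have [le|le] := leP ca cb.
      by rewrite lerDl invr_ge0 ltW.
    by rewrite lerDr invr_ge0 ltW.
  rewrite -leqNgt leqn0 => /eqP k0.
  by rewrite lerDl invr_ge0 /cb divr_ge0 ?ler0n // mulr_ge0 ?sqr_ge0 // mulr_ge0 ?sqr_ge0 // ltW.
have c_ca : c <= ca by rewrite /c; case: ifP => // _; rewrite ge_min lexx.
have modelE t : \col_i Y n i t =
    (\matrix_(i, j) tnth (X n i t) j) *m beta n + \col_i eps n i t.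
  apply/colP => i; rewrite !mxE model; congr (_ + _); rewrite !mxE.
  by apply: eq_bigr => j _; rewrite !mxE.
have est t : is_ls_scad_estimate (\matrix_(i, j) tnth (X n i t) j)
    ((\matrix_(i, j) tnth (X n i t) j) *m beta n + \col_i eps n i t)
    (lambda n) a (col_of (bhat n t)).
  by rewrite -modelE; exact: estimator.
have beta_big j : beta n j 0 != 0 -> 2 * a * lambda n <= `|beta n j 0| /\
     16 * c / (n%:R ^+ 2 * rho1 n) +
     2 * (#|[pred j | beta n j 0 != 0]|)%:R * (a + 1) * lambda n ^+ 2 / rho1 n
       <= `|beta n j 0| ^+ 2 / 4.
  move=> bj; have [i jE] : exists i, j = lshift (m n) i.
    case: (split_ordP j) bj => i -> bi; first by exists i.
    by have /matrixP /(_ i 0) := beta2_eq0 n; rewrite !mxE => b0; rewrite b0 eqxx in bi.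
  have k_gt0 : (0 < k n)%N by exact: leq_ltn_trans (ltn_ord i).
  have mb0 := mb_gt0 k_gt0; have cb0 := cb_gt0 k_gt0.
  have mb_le : mb n <= `|beta n j 0|.
    by have := min_abs_le (usubmx (beta n)) i; rewrite mxE -jE.
  have mb2_le : mb n ^+ 2 <= `|beta n j 0| ^+ 2.
    by rewrite lerXn2r ?nnegrE // ltW.
  have x2E : x n ^+ 2 = (k n)%:R * lambda n ^+ 2 / (rho1 n * mb n ^+ 2).
    by rewrite /x exprMn exprVn !exprMn !sqrt_sqr ?ler0n ?ltW // [lambda n ^+ 2 * _]mulrC.
  have rho1_le1 : rho1 n <= 1.
    by have := Srho n (delta_mx j 0); rewrite !bilin_delta Sdiag mxE eqxx mulr1.
  pose delta := (4 * (a + 1))^-1.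
  have x2_le : x n ^+ 2 <= delta ^+ 2.
    by rewrite -real_normK ?num_real // lerXn2r ?nnegrE // ltW.
  have kl_le : (k n)%:R * lambda n ^+ 2 / rho1 n <= delta ^+ 2 * mb n ^+ 2.
    have -> : (k n)%:R * lambda n ^+ 2 / rho1 n = x n ^+ 2 * mb n ^+ 2.
      by rewrite x2E; field; rewrite !gt_eqF.
    by rewrite ler_pM2r // exprn_gt0.
  have a_delta : 4 * (a + 1) * delta = 1 by rewrite mulfV // gt_eqF // mulr_gt0.
  have delta0 : 0 < delta by exact: delta_gt0.
  split.
    have l_le : lambda n <= delta * mb n.
      rewrite -(@ler_pXn2r _ 2) ?nnegrE ?mulr_ge0 ?(ltW l_gt0) ?(ltW mb0) ?(ltW delta0) //.
      rewrite exprMn; apply: le_trans kl_le.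
      rewrite ler_pdivlMr //; apply: (@le_trans _ _ (lambda n ^+ 2)).
        by rewrite ler_piMr // sqr_ge0.
      by rewrite ler_peMl ?sqr_ge0 // ler1n.
    apply: (@le_trans _ _ (2 * a * (delta * mb n))).
      by rewrite ler_pM2l // mulr_gt0 //; lra.
    apply: le_trans mb_le; rewrite mulrA ler_piMl ?(ltW mb0) //.
    have : 0 <= a * delta by rewrite mulr_ge0 ?(ltW delta0) //; lra.
    lra.
  (* The two summands take 1/16 and 1/8 of min|beta_j|^2, together less than 1/4. *)
  apply: (@le_trans _ _ (mb n ^+ 2 / 4)); last by lra.
  have t1 : 16 * c / (n%:R ^+ 2 * rho1 n) <= mb n ^+ 2 / 16.
    have c_cb : c <= cb by rewrite /c k_gt0 ge_min lexx orbT.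
    have -> : mb n ^+ 2 / 16 = 16 * cb / (n%:R ^+ 2 * rho1 n).
      by rewrite /cb; field; rewrite !gt_eqF.
    rewrite ler_pM2r ?invr_gt0 ?mulr_gt0 ?exprn_gt0 //.
    by rewrite ler_pM2l.
  have t2 : 2 * (#|[pred j | beta n j 0 != 0]|)%:R * (a + 1) * lambda n ^+ 2 / rho1 n
      <= mb n ^+ 2 / 8.
    apply: (@le_trans _ _ (2 * (a + 1) * ((k n)%:R * lambda n ^+ 2 / rho1 n))).
      set K := #|_|; have -> : 2 * K%:R * (a + 1) * lambda n ^+ 2 / rho1 n =
        2 * (a + 1) * (K%:R * (lambda n ^+ 2 / rho1 n)) by ring.
      rewrite ler_pM2l ?mulr_gt0 // -mulrA ler_wpM2r ?divr_ge0 ?sqr_ge0 ?(ltW rho_gt0) //.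
      by rewrite ler_nat.
    apply: (@le_trans _ _ (2 * (a + 1) * (delta ^+ 2 * mb n ^+ 2))).
      by rewrite ler_pM2l ?mulr_gt0.
    have -> : 2 * (a + 1) * (delta ^+ 2 * mb n ^+ 2) =
      (4 * (a + 1) * delta) * delta * mb n ^+ 2 / 2 by field.
    rewrite a_delta mul1r.
    have : delta * mb n ^+ 2 <= 4^-1 * mb n ^+ 2.
      rewrite ler_pM2r ?exprn_gt0 // /delta lef_pV2 ?posrE ?mulr_gt0 //; lra.
    lra.
  by have := sqr_ge0 (mb n); lra.
have c_small : (2 + 6 * M' + 4 * M' ^+ 2) ^+ 2 * c <= n%:R ^+ 2 * lambda n ^+ 2 * rho1 n.
  by rewrite mulrC -ler_pdivlMr.
have := @selection_probability R _ _ (P n) n (k n + m n) sigma M' (X n) (eps n)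
  (X0 n) (eps0 n) n_gt0 Xb (indep n) (ident n) (X_mean n) (X_var n) (eps_mean n)
  (eps_var n) (beta n) (bhat n) (lambda n) a (rho1 n) c a_gt2 l_gt0 rho_gt0 M1 c_gt0
  (Srho n) est beta_big c_small.
apply: le_trans; rewrite lee_fin lerD2l lerN2 /B -addrA lerD2l.
apply: (@le_trans _ _ (n%:R * sigma ^+ 2 * (k n + m n)%:R * (ca^-1 + cb^-1))).
  by rewrite ler_wpM2l // mulr_ge0 ?ler0n // mulr_ge0 ?ler0n ?sqr_ge0.
rewrite mulrDr lerD //.
  have caE : n%:R * sigma ^+ 2 * (k n + m n)%:R / ca =
      C * sigma ^+ 2 * ((k n + m n)%:R / (n%:R * lambda n ^+ 2 * rho1 n)).
    by rewrite /ca; field; rewrite !gt_eqF.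
  rewrite caE ler_wpM2l //; first by rewrite mulr_ge0 ?sqr_ge0 // ltW.
  have [p0|p_gt0] := posnP (k n + m n); first by rewrite p0 mul0r sqr_ge0.
  (* The term from [ca] has rho_1 in its denominator where z^2 has rho_1^2 / max(pi, omega); rho_1
     <= 1 <= max(pi, omega) closes the gap. *)
  have rho1_le1 : rho1 n <= 1.
    have := Srho n (delta_mx (Ordinal p_gt0) 0).
    by rewrite !bilin_delta Sdiag mxE eqxx mulr1.
  have max_ge1 : 1 <= Num.max (pik n) (omegam n).
    by rewrite pikE omegamE; exact: max_largest_eigenvalue_ge1.
  have pR : 0 < (k n + m n)%:R :> R by rewrite ltr0n.
  rewrite /z exprMn exprVn !exprMn !sqrt_sqr ?ler0n //; last first.
    by rewrite mulr_ge0 // (le_trans ler01).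
  rewrite ler_pdivrMr ?mulr_gt0 ?exprn_gt0 //.
  set mx := Num.max _ _ in max_ge1 *.
  have -> : mx * (k n + m n)%:R / (n%:R * rho1 n ^+ 2 * lambda n ^+ 2) *
      (n%:R * lambda n ^+ 2 * rho1 n) = (k n + m n)%:R * (mx / rho1 n).
    by field; rewrite !gt_eqF.
  by rewrite ler_peMr ?ler0n // ler_pdivlMr // mul1r (le_trans rho1_le1).
rewrite /y exprMn exprVn !exprMn !sqrt_sqr ?ler0n ?mulr_ge0 ?ler0n ?(ltW rho_gt0) //.
rewrite le_eqVlt; apply/orP; left; apply/eqP; rewrite /cb.
(* With [mb n] = 0 both sides vanish by the convention that 0 has inverse 0. *)
have [->|mb0] := eqVneq (mb n) 0.
  by rewrite expr0n /= !mulr0 mul0r invr0 !mulr0.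
by field; rewrite mb0 !gt_eqF.
Unshelve. all: by end_near.
Qed.
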